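(* Fix $\gamma>0$. Let $(V_M)_{M\ge1}$ be a sequence of finite-dimensional subspaces of $L^2(\mu)$, let $\Pi_M$ be the orthogonal projector onto $V_M$, set $V_{M,0}=V_M\cap L_0^2(\mu)$ with associated orthogonal projector $\Pi_{M,0}$, and $u_M=\Pi_M\mathbf 1/\|\Pi_M\mathbf 1\|$. Assume that $$\big\|(A+A^* )(1-\Pi_M)\mathcal L\,\Pi_M\big\|\xrightarrow[M\to\infty]{}0\qquad\text{and}\qquad\|\mathcal L^*u_M\|\xrightarrow[M\to\infty]{}0 .$$ Then there exist $C\ge1$ (independent of $M$ and $\gamma$), $M_0\ge1$ and, for $M\ge M_0$, numbers $\widehat\lambda_{\gamma,M}>0$ with $\widehat\lambda_{\gamma,M}\to\lambda_\gamma$ as $M\to\infty$, for which $\Pi_{M,0}\mathcal L\Pi_{M,0}$ is invertible on $V_{M,0}$ with $\|(\Pi_{M,0}\mathcal L\Pi_{M,0})^{-1}\|_{\mathcal B(V_{M,0})}\le C/\widehat\lambda_{\gamma,M}$, and such that the following holds for all $M\ge M_0$ and all $R\in L^2(\mu)$: if $\Phi\in L_0^2(\mu)$ is the unique solution of $-\mathcal L\Phi=\Pi_0R$ and $\Phi_M\in V_{M,0}$ is the unique solution of $-\Pi_{M,0}\mathcal L\Pi_{M,0}\Phi_M=\Pi_{M,0}R$, then $$\|\Phi_M-\Pi_{M,0}\Phi\|\le\frac{C}{\widehat\lambda_{\gamma,M}}\Big(\|\Pi_M\mathcal L(1-\Pi_M)\Phi\|+\|\mathcal Lu_M\|\,\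|\Phi\|\Big).$$
   Context: Setting. $D\ge 1$ is an integer; the position space $\mathcal D$ is either a torus $(a\mathbb T)^D$, $\mathbb T=\mathbb R/\mathbb Z$, $a>0$, or $\mathbb R^D$; $\beta,m,\gamma>0$; $V:\mathcal D\to\mathbb R$ is smooth with $\mathrm e^{-\beta V}$ integrable. Probability measures: $\mu(dq\,dp)=Z_\mu^{-1}\mathrm e^{-\beta(V(q)+|p|^2/(2m))}dq\,dp$ on $\mathcal D\times\mathbb R^D$, with marginals $\nu(dq)=Z_\nu^{-1}\mathrm e^{-\beta V(q)}dq$ and $\kappa(dp)=(\beta/(2\pi m))^{D/2}\mathrm e^{-\beta|p|^2/(2m)}dp$. $\langle\cdot,\cdot\rangle$ and $\|\cdot\|$ are the scalar product and norm of $L^2(\mu)$, also $\|\cdot\|$ denotes the operator norm on $L^2(\mu)$; $\mathcal B(E)$ is the space of bounded operators on $E$ with its operator norm; $^*$ is the adjoint on $L^2(\mu)$; $\mathbf 1$ is the constant function equal to 1. $L_0^2(\mu)=\{\varphi\in L^2(\mu):\int\varphi\,d\mu=0\}$, and $\Pi_0\varphi=\varphi-\int\varphi\,d\mu$. Standing assumption on $V$: there is $C_\nu>0$ with $\|\varphi-\int\varphi\,d\nu\|_{L^2(\nu)}^2\le C_\nu^{-1}\|\nabla_q\varphi\|^2_{L^2(\nu)}$ for all $\varphi\in H^1(\nu)$, and there are $c_1>0$, $c_2\in[0,1)$, $c_3>0$ with $\Delta V\le c_1+\frac{c_2}{2}|\nabla V|^2$ and $|\nabla^2V|\le c_3(1+|\nabla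 V|)$. Operators: $\mathcal L=\mathcal L_{\mathrm{ham}}+\gamma\mathcal L_{\mathrm{FD}}$ (generator of the Langevin dynamics, a closed operator on $L^2(\mu)$), with $\mathcal L_{\mathrm{ham}}=\frac{p}{m}\cdot\nabla_q-\nabla V\cdot\nabla_p$ and $\mathcal L_{\mathrm{FD}}=-\frac pm\cdot\nabla_p+\frac1\beta\Delta_p$; $\mathcal L^*=-\mathcal L_{\mathrm{ham}}+\gamma\mathcal L_{\mathrm{FD}}$. It is known that $\mathcal L$ is invertible on $L_0^2(\mu)$ with bounded inverse. $(\Pi_p\varphi)(q)=\int_{\mathbb R^D}\varphi(q,p)\,\kappa(dp)$. The bounded operator $A$ is $A=\big(1+(\mathcal L_{\mathrm{ham}}\Pi_p)^*(\mathcal L_{\mathrm{ham}}\Pi_p)\big)^{-1}(\mathcal L_{\mathrm{ham}}\Pi_p)^*$. The elements of $V_M$ are assumed regular enough (in the domains of $\mathcal L$, $\mathcal L^*$) for all expressions to be defined, and $\Pi_M\mathbf 1\neq0$. Constants (from known hypocoercivity results). There exist $\overline\varepsilon\in(0,1)$, $\overline\lambda>0$ and, for each $\gamma>0$, $\widetilde\lambda_\gamma>0$ such that, with $\varepsilon=\overline\varepsilon\min(\gamma,\gamma^{-1})$, for all $\varphi\in\Pi_0C_c^\infty(\mathcal D\times\mathbb R^D)$, $$\langle-\mathcal L\varphi,\varphi\rangle+\varepsilon\langle A\mathcal L\varphi,\varphi\rangle+\varepsilon\langle A\varphi,\mathcal L\varphi\rangle\ \ge\ \widetilde\lambda_\gamma\|\varphi\|^2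 .$$ These are fixed, and $\lambda_\gamma:=\widetilde\lambda_\gamma/(1+\varepsilon)$, with $\lambda_\gamma\ge\overline\lambda\min(\gamma,\gamma^{-1})$. The rate $\lambda_\gamma$ is the one for which $\|\mathrm e^{t\mathcal L}\varphi\|\le C\mathrm e^{-\lambda_\gamma t}\|\varphi\|$ for all $\varphi\in L_0^2(\mu)$, $t\ge0$, with $C$ independent of $\gamma$. *)

(* Defs.v *)
From HB Require Import structures.
From mathcomp Require Import all_boot all_order all_algebra.
From mathcomp Require Import all_classical all_reals all_analysis.
Set Implicit Arguments.
Unset Strict Implicit.
Unset Printing Implicit Defensive.
Import Order.TTheory GRing.Theory Num.Theory.
Import numFieldNormedType.Exports.
Local Open Scope classical_set_scope.
Local Open Scope ring_scope.


Section measurable_rV.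
Context {R : realType}.
Variable n : nat.

Let coors : 'I_n -> 'rV[R]_n -> R := fun i x => x ord0 i.

Let rV_set0 : g_sigma_preimage coors set0.
Proof. exact: sigma_algebra0. Qed.

Let rV_setC A : g_sigma_preimage coors A -> g_sigma_preimage coors (~` A).
Proof. exact: sigma_algebraC. Qed.

Let rV_bigcup (F : _^nat) : (forall i, g_sigma_preimage coors (F i)) ->
  g_sigma_preimage coors (\bigcup_i (F i)).
Proof. exact: sigma_algebra_bigcup. Qed.

HB.instance Definition _ := @isMeasurable.Build default_measure_display
  'rV[R]_n (g_sigma_preimage coors) rV_set0 rV_setC rV_bigcup.

End measurable_rV.

Lemma measurable_rV_coord (R : realType) n (i : 'I_n) :
  measurable_fun [set: 'rV[R]_n] (fun x => x ord0 i).
Proof.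
move=> _ Y mY; rewrite setTI; apply: sub_sigma_algebra => /=.
rewrite -bigcup_seq/=; exists i => /=; first by rewrite mem_index_enum.
by exists Y => //; rewrite setTI.
Qed.

Lemma measurable_fun_rV d (T : measurableType d) (R : realType) n
    (f : T -> 'rV[R]_n) :
  (forall i, measurable_fun [set: T] (fun x => f x ord0 i)) ->
  measurable_fun [set: T] f.
Proof.
move=> mf.
suff : g_sigma_preimage (fun i x => f x ord0 i) `<=` measurable.
  pose c := fun (i : 'I_n) (x : 'rV[R]_n) => x ord0 i.
  rewrite -[fun i x => _]/(fun i => c i \o f) g_sigma_preimage_comp => preS.
  by move=> _ A mA; apply: preS; exists A.
apply: smallest_sub; first exact: sigma_algebra_measurable.
rewrite -bigcup_seq; apply: bigcup_sub => i _ A [B mB <-].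
exact: mf.
Qed.

Definition cons_rV {R : realType} n (x : measurableTypeR R * 'rV[R]_n) : 'rV[R]_n.+1 :=
  \row_i oapp (x.2 ord0) x.1 (unlift ord0 i).

Lemma measurable_cons_rV (R : realType) n :
  measurable_fun [set: measurableTypeR R * 'rV[R]_n] (@cons_rV R n).
Proof.
apply: measurable_fun_rV => i; case: (unliftP ord0 i) => [j|] ->.
  rewrite (_ : (fun _ => _) = (fun y : 'rV[R]_n => y ord0 j) \o snd).
    by apply: measurableT_comp => //; exact: measurable_rV_coord.
  by apply/funext => x; rewrite mxE liftK.
rewrite (_ : (fun _ => _) = fst)//.
by apply/funext => x; rewrite mxE unlift_none.
Qed.

Section lebesgue_cons.
Context {R : realType} {n : nat}.
Variable m : {sigma_finite_measure set 'rV[R]_n -> \bar R}.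

Definition lebesgue_cons : set 'rV[R]_n.+1 -> \bar R :=
  pushforward (lebesgue_measure \x m)%E (@cons_rV R n).

Let uncons (x : 'rV[R]_n.+1) : measurableTypeR R * 'rV[R]_n :=
  (x ord0 ord0, \row_i x ord0 (lift ord0 i)).

Let consK : cancel (@cons_rV R n) uncons.
Proof.
case=> x y; rewrite /uncons !mxE unlift_none; congr pair.
by apply/rowP => i; rewrite !mxE liftK.
Qed.

Let measurable_uncons : measurable_fun [set: 'rV[R]_n.+1] uncons.
Proof.
apply: measurable_fun_pair; first exact: measurable_rV_coord.
apply: measurable_fun_rV => i.
rewrite (_ : (fun _ => _) = fun x : 'rV[R]_n.+1 => x ord0 (lift ord0 i)).
  exact: measurable_rV_coord.
by apply/funext => x; rewrite mxE.
Qed.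

Let lebesgue_cons0 : lebesgue_cons set0 = 0%E.
Proof. by rewrite /lebesgue_cons /pushforward preimage_set0 measure0. Qed.

Let lebesgue_cons_ge0 A : (0 <= lebesgue_cons A)%E.
Proof. by rewrite /lebesgue_cons /pushforward. Qed.

Let measurable_preimage A : measurable A -> measurable (@cons_rV R n @^-1` A).
Proof. by rewrite -[_ @^-1` _]setTI; exact: measurable_cons_rV. Qed.

Let lebesgue_cons_sigma_additive : semi_sigma_additive lebesgue_cons.
Proof.
move=> F mF tF mUF; rewrite /lebesgue_cons /pushforward preimage_bigcup.
apply: measure_semi_sigma_additive.
- by move=> i; exact: measurable_preimage.
- apply/trivIsetP => /= i j _ _ ij; rewrite -preimage_setI.
  by move/trivIsetP : tF => /(_ _ _ _ _ ij) ->//; rewrite preimage_set0.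
- by rewrite -preimage_bigcup; exact: measurable_preimage.
Qed.

HB.instance Definition _ := isMeasure.Build _ _ _ lebesgue_cons
  lebesgue_cons0 lebesgue_cons_ge0 lebesgue_cons_sigma_additive.

Let lebesgue_cons_sigma_finite : sigma_finite setT lebesgue_cons.
Proof.
have /sigma_finiteP[F [TF ndF Foo]] := sigma_finiteT (@lebesgue_measure R).
have /sigma_finiteP[G [TG ndG Goo]] := sigma_finiteT m.
exists (fun i => uncons @^-1` (F i `*` G i)) => [|i].
  apply/esym/seteqP; split => // x _; rewrite -preimage_bigcup /=.
  have : [set: measurableTypeR R] (uncons x).1 by [].
  have : [set: 'rV[R]_n] (uncons x).2 by [].
  rewrite TF TG => -[k _ Gk] [l _ Fl]; exists (maxn k l) => //; split.
    by move: Fl; exact/subsetPset/ndF/leq_maxr.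
  by move: Gk; exact/subsetPset/ndG/leq_maxl.
have [mF Fy] := Foo i; have [mG Gy] := Goo i.
split.
  rewrite -[_ @^-1` _]setTI; apply: measurable_uncons => //.
  exact: measurableX.
rewrite /lebesgue_cons /pushforward -comp_preimage.
have -> : uncons \o @cons_rV R n = id by apply/funext => x; exact: consK.
rewrite preimage_id product_measure1E//.
by rewrite lte_mul_pinfty// ge0_fin_numE.
Qed.

HB.instance Definition _ := Measure_isSigmaFinite.Build _ _ _ lebesgue_cons
  lebesgue_cons_sigma_finite.

End lebesgue_cons.

Fixpoint lebesgue_rV (R : realType) n :
    {sigma_finite_measure set 'rV[R]_n -> \bar R} :=
  match n with
  | 0 => \d_(0 : 'rV[R]_0)
  | n'.+1 => lebesgue_cons (lebesgue_rV R n')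
  end.

Lemma lebesgue_rV_box (R : realType) n (B : 'I_n -> set R) :
  (forall i, measurable (B i)) ->
  lebesgue_rV R n [set x | forall i, B i (x ord0 i)] =
  (\prod_(i < n) lebesgue_measure (B i))%E.
Proof.
elim: n B => [|n IHn] B mB; first by rewrite big_ord0 /= diracE mem_set// => -[].
have mbox : measurable [set x : 'rV[R]_n | forall i, B (lift ord0 i) (x ord0 i)].
  rewrite [X in measurable X](_ : _ = \bigcap_(i in [set: 'I_n])
      [set x : 'rV[R]_n | B (lift ord0 i) (x ord0 i)]); last first.
    by apply/seteqP; split => x /= H i; [move=> _; exact: H|exact: (H i I)].
  apply: fin_bigcap_measurable => // i _.
  rewrite -[X in measurable X]setTI.
  exact: (@measurable_rV_coord R n i measurableT _ (mB _)).
rewrite big_ord_recl -IHn//.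
transitivity ((lebesgue_measure \x lebesgue_rV R n)%E
    (B ord0 `*` [set x : 'rV[R]_n | forall i, B (lift ord0 i) (x ord0 i)])); last first.
  apply: (@product_measure1E _ _ (measurableTypeR R) 'rV[R]_n R
    lebesgue_measure (lebesgue_rV R n)); first exact: mB.
  exact: mbox.
rewrite /= /lebesgue_cons /pushforward; congr (_ _).
apply/seteqP; split=> [[x y] /= H|[x y] /= [Bx By] i].
  split => [|i]; first by have := H ord0; rewrite mxE unlift_none.
  by have := H (lift ord0 i); rewrite mxE liftK.
by rewrite mxE; case: (unliftP ord0 i) => [j|] -> //=.
Qed.

(* Elements are square-integrable functions, not classes: equality in        *)
(* L^2(mu) is [aeq], and the sets and graphs below are invariant under it.   *)
Notation L2 mu := (LfunType mu (lee1n 2)).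

Section L2_operators.
Context {d : measure_display} {T : measurableType d} {R : realType}.
Context {mu : probability T R}.
Implicit Types (f g h : L2 mu) (W : set (L2 mu)) (S : set (L2 mu * L2 mu)).

Definition dot f g : R := \int[mu]_x (f x * g x).
Definition nrm f : R := Num.sqrt (dot f f).
Definition aeq f g : Prop := {ae mu, forall x, f x = g x}.

Definition L2cst (c : R) : L2 mu := Lfun_Sub (lee1n 2) (Lfun_cst mu c 2).
Definition mean f : R := \int[mu]_x f x.
Definition L20 : set (L2 mu) := [set f | mean f = 0].
Definition Pi0 f : L2 mu := f - mean f *: L2cst 1.

(* Unbounded operators are handled through their graphs. *)
Record operator := Operator { dom : set (L2 mu) ; fn :> L2 mu -> L2 mu }.
Definition graph (B : operator) : set (L2 mu * L2 mu) :=
  [set fg | dom B fg.1 /\ aeq fg.2 (B fg.1)].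

Definition rel_closure S : set (L2 mu * L2 mu) :=
  [set fg | forall e, 0 < e ->
    exists uv, [/\ S uv, nrm (uv.1 - fg.1) < e & nrm (uv.2 - fg.2) < e]].
Definition rel_adjoint S : set (L2 mu * L2 mu) :=
  [set gh | forall uv, S uv -> dot uv.2 gh.1 = dot uv.1 gh.2].
Definition rel_comp S1 S2 : set (L2 mu * L2 mu) :=
  [set fh | exists2 g, S2 (fh.1, g) & S1 (g, fh.2)].
Definition rel_inv S : set (L2 mu * L2 mu) := [set fg | S (fg.2, fg.1)].
Definition rel_add1 S : set (L2 mu * L2 mu) :=
  [set fg | exists2 h, S (fg.1, h) & aeq fg.2 (fg.1 + h)].

Definition finite_dim_subspace W : Prop :=
  exists n (b : 'I_n -> L2 mu),
    W = [set f | exists c : 'I_n -> R, aeq f (\sum_i c i *: b i)].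

(* The orthogonal projector onto [W] (for [W] of finite dimension). *)
Definition orth_proj W f : L2 mu :=
  xget 0 [set g | W g /\ forall h, W h -> dot (f - g) h = 0].

(* Norm of [B] as an operator on [W]; [W = setT] gives the norm on L^2(mu). *)
Definition opnorm_on W (B : L2 mu -> L2 mu) : \bar R :=
  ereal_sup [set (nrm (B f))%:E | f in [set f | W f /\ nrm f <= 1]].

Definition invertible_on W (B : L2 mu -> L2 mu) : Prop :=
  (forall f, W f -> W (B f)) /\
  forall g, W g -> exists2 f, W f /\ aeq (B f) g &
    forall f', W f' -> aeq (B f') g -> aeq f' f.
Definition inverse_on W (B : L2 mu -> L2 mu) g : L2 mu :=
  xget 0 [set f | W f /\ aeq (B f) g].

End L2_operators.
Arguments operator {d T R} mu.

(* [Torus a] is (aT)^D.  A function on it is an a-periodic function on R^D,   *)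
(* and integrals are over the fundamental cell [0, a[^D.                     *)
Inductive position_space (R : realType) := Torus of {posnum R} | Euclidean.
Arguments Euclidean {R}.

Section phase_space.
Context {R : realType} {D : nat}.
Variable X : position_space R.
Notation pos := 'rV[R]_D.
Notation phase := ('rV[R]_D * 'rV[R]_D)%type.

Definition cell : set pos :=
  if X is Torus a then [set q | forall i, 0 <= q ord0 i < a%:num] else setT.

Definition cell_periodic (f : pos -> R) : Prop :=
  if X is Torus a then
    forall q i, f (q + a%:num *: delta_mx ord0 i) = f q
  else True.

(* The compact subsets of the torus are unrestricted in this sense. *)
Definition position_bounded (K : R) (q : pos) : Prop :=
  if X is Torus _ then True else `|q| <= K.

Fixpoint Ck (U : normedModType R) (k : nat) (f : U -> R) : Prop :=
  continuous f /\
  if k is k'.+1 then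
    forall v, (forall x, derivable f x v) /\ Ck k' ('D_v f)
  else True.
Definition smooth (U : normedModType R) (f : U -> R) : Prop :=
  forall k, Ck k f.

Definition smooth_position (f : pos -> R) : Prop := smooth f /\ cell_periodic f.

Definition test_position (f : pos -> R) : Prop :=
  smooth_position f /\
  exists K, forall q, f q != 0 -> position_bounded K q.

Definition test_phase (f : phase -> R) : Prop :=
  [/\ smooth f, forall p, cell_periodic (fun q => f (q, p)) &
    exists K, forall x, f x != 0 -> position_bounded K x.1 /\ `|x.2| <= K].

Definition partial (i : 'I_D) (f : pos -> R) : pos -> R :=
  'D_(delta_mx ord0 i) f.
Definition partial_q (i : 'I_D) (f : phase -> R) : phase -> R :=
  'D_(delta_mx ord0 i, 0) f.
Definition partial_p (i : 'I_D) (f : phase -> R) : phase -> R :=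
  'D_(0, delta_mx ord0 i) f.

(* The Euclidean norm; the library norm on 'rV is the max norm. *)
Definition sqnorm (v : pos) : R := \sum_i v ord0 i ^+ 2.
Definition grad (f : pos -> R) (q : pos) : pos := \row_i partial i f q.
Definition laplacian (f : pos -> R) (q : pos) : R :=
  \sum_i partial i (partial i f) q.
(* Frobenius norm; the constant in the growth condition is existential, so   *)
(* the choice of the matrix norm is immaterial.                              *)
Definition hessian_norm (f : pos -> R) (q : pos) : R :=
  Num.sqrt (\sum_i \sum_j partial i (partial j f) q ^+ 2).

Definition weak_gradient (nu : probability pos R) (phi : L2 nu)
    (g : 'I_D -> L2 nu) : Prop :=
  forall eta i, test_position eta ->
    \int[lebesgue_rV R D]_(q in cell) (phi q * partial i eta q) =
    - \int[lebesgue_rV R D]_(q in cell) (g i q * eta q).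

Definition poincare (nu : probability pos R) (c : R) : Prop :=
  forall (phi : L2 nu) (g : 'I_D -> L2 nu), weak_gradient phi g ->
    nrm (Pi0 phi) ^+ 2 <= c^-1 * \sum_i nrm (g i) ^+ 2.

Section langevin.
Variables (V : pos -> R) (beta m : R).

(* [P] has density proportional to [w] on [C] with respect to [leb]. *)
Definition normalized_density d (T : measurableType d)
    (leb : set T -> \bar R) (C : set T) (w : T -> R) (P : set T -> \bar R) :=
  forall A, measurable A ->
    P A = (((fine (\int[leb]_(x in C) (w x)%:E))^-1)%:E *
           \int[leb]_(x in A `&` C) (w x)%:E)%E.

Definition is_mu (mu : probability phase R) : Prop :=
  normalized_density (lebesgue_rV R D \x lebesgue_rV R D)%E
    (cell `*` setT)
    (fun x => expR (- beta * (V x.1 + sqnorm x.2 / (2 * m)))) mu.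

Definition is_nu (nu : probability pos R) : Prop :=
  normalized_density (lebesgue_rV R D) cell (fun q => expR (- beta * V q)) nu.

Definition is_kappa (kappa : probability pos R) : Prop :=
  forall A, measurable A ->
    (kappa A = \int[lebesgue_rV R D]_(p in A)
      ((beta / (2 * pi * m)) `^ (D%:R / 2) *
       expR (- beta * (sqnorm p / (2 * m))))%:E)%E.

Definition Lham (f : phase -> R) (x : phase) : R :=
  \sum_i (x.2 ord0 i / m * partial_q i f x -
          partial i V x.1 * partial_p i f x).
Definition LFD (f : phase -> R) (x : phase) : R :=
  \sum_i (- (x.2 ord0 i / m) * partial_p i f x +
          beta^-1 * partial_p i (partial_p i f) x).
Definition langevin (gamma : R) (f : phase -> R) (x : phase) : R :=
  Lham f x + gamma * LFD f x.

Section phase_L2.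
Variables (mu : probability phase R) (kappa : probability pos R).

(* The closed operator on L^2(mu) with core C_c^oo on which it is [B]. *)
Definition core_closure (B : (phase -> R) -> phase -> R) :
    set (L2 mu * L2 mu) :=
  rel_closure
    [set fg : L2 mu * L2 mu | test_phase fg.1 /\ forall x, fg.2 x = B fg.1 x].

Definition Pip : set (L2 mu * L2 mu) :=
  [set fg : L2 mu * L2 mu |
    {ae mu, forall x, fg.2 x = \int[kappa]_p fg.1 (x.1, p)} ].

Definition LhamPip : set (L2 mu * L2 mu) :=
  rel_comp (core_closure Lham) Pip.

(* (1 + S^* S)^-1 S^* with S = L_ham Pi_p is densely defined (on the domain   *)
(* of S^* ) and bounded; [A] is its extension to L^2(mu).                     *)
Definition is_A (A : L2 mu -> L2 mu) : Prop :=
  forall f g,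
    rel_closure (rel_comp
      (rel_inv (rel_add1 (rel_comp (rel_adjoint LhamPip) LhamPip)))
      (rel_adjoint LhamPip)) (f, g) <-> aeq g (A f).

Definition is_generator (gamma : R) (L : operator mu) : Prop :=
  graph L = core_closure (langevin gamma).

End phase_L2.
End langevin.
End phase_space.

(* Main.v *)
(** Write [B = A + A^*] and [eps] for the hypocoercivity weight.  The inequality
    [<-L f, f> + eps <L f, B f> >= lamt |f|^2] extends from the core to all
    mean-zero [f] in the domain of [L] because [|A| <= 1/2].  On the other hand
    [V_M] is the orthogonal sum of [V_{M,0}] and the line of [u_M], so that
    [Pi_M - Pi_{M,0} = <., u_M> u_M].  For [f] in [V_{M,0}], replacing [L f] by
    [Pi_{M,0} L f] on the left-hand side therefore costs
    [eps <B (1 - Pi_M) L Pi_M f, f>] and [eps <f, L^* u_M> <u_M, B f>].  With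
    [delta_M] the norm of [B (1 - Pi_M) L Pi_M] and [|B| <= 1] this gives
    [|Pi_{M,0} L f| >= lamhat |f|] for
    [lamhat = (lamt - eps (delta_M + |L^* u_M|)) / (1 + eps)], which tends to
    [lamt / (1 + eps)]; so [C = 1] works.  The error bound is this inequality
    for [f = Phi_M - Pi_{M,0} Phi], since then
    [Pi_{M,0} L f = Pi_{M,0} (L (1 - Pi_M) Phi + <Phi, u_M> L u_M)]. *)

Require Import Defs.
From HB Require Import structures.
From mathcomp Require Import all_boot all_order all_algebra.
From mathcomp Require Import all_classical all_reals all_analysis.
From mathcomp Require Import ring lra.
Import Order.TTheory GRing.Theory Num.Theory.
Import numFieldNormedType.Exports.
Local Open Scope classical_set_scope.
Local Open Scope ring_scope.

(** * The semi-inner product of L^2(mu) and equality almost everywhere *)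

Section L2_calculus.
Local Set Implicit Arguments.
Local Unset Strict Implicit.
Context (d : measure_display) (T : measurableType d) (R : realType).
Context (mu : probability T R).
Implicit Types (f g h : L2 mu) (a : R).

Lemma L2_mul_integrable f g :
  mu.-integrable setT (EFin \o (fun x => f x * g x)).
Proof. by apply/Lfun1_integrable; apply: Lfun2_mul_Lfun1; exact: LfunP. Qed.

Lemma dotC f g : dot f g = dot g f.
Proof. by apply: eq_Rintegral => x _; rewrite mulrC. Qed.

Lemma dotDl f g h : dot (f + g) h = dot f h + dot g h.
Proof.
rewrite /dot -(RintegralD measurableT (L2_mul_integrable _ _) (L2_mul_integrable _ _)).
by apply: eq_Rintegral => x _; rewrite /= mulrDl.
Qed.

Lemma dotZl a f h : dot (a *: f) h = a * dot f h.
Proof.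
rewrite /dot -(RintegralZl _ measurableT (L2_mul_integrable _ _)).
by apply: eq_Rintegral => x _; rewrite /= mulrA.
Qed.

Lemma dotNl f h : dot (- f) h = - dot f h.
Proof. by rewrite -scaleN1r dotZl mulN1r. Qed.

Lemma dotBl f g h : dot (f - g) h = dot f h - dot g h.
Proof. by rewrite dotDl dotNl. Qed.

Lemma dot0l h : dot 0 h = 0.
Proof. by rewrite -(scale0r (0 : L2 mu)) dotZl mul0r. Qed.

Lemma dotDr f g h : dot h (f + g) = dot h f + dot h g.
Proof. by rewrite dotC dotDl !(dotC h). Qed.

Lemma dotZr a f h : dot h (a *: f) = a * dot h f.
Proof. by rewrite dotC dotZl dotC. Qed.

Lemma dotNr f h : dot h (- f) = - dot h f.
Proof. by rewrite dotC dotNl dotC. Qed.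

Definition dotE := (dotDl, dotDr, dotNl, dotNr, dotZl, dotZr).

Lemma dot_suml n (F : 'I_n -> L2 mu) h :
  dot (\sum_i F i) h = \sum_i dot (F i) h.
Proof. exact: (big_morph (dot^~ h) (fun f g => dotDl f g h) (dot0l h)). Qed.

Lemma dot_ge0 f : 0 <= dot f f.
Proof. by apply: Rintegral_ge0 => x _; rewrite -expr2 sqr_ge0. Qed.

Lemma nrm_ge0 f : 0 <= nrm f.
Proof. exact: sqrtr_ge0. Qed.

Lemma sqr_nrm f : nrm f ^+ 2 = dot f f.
Proof. by rewrite sqr_sqrtr ?dot_ge0. Qed.

Lemma dotff_eq0 f : dot f f = 0 -> aeq f 0.
Proof.
move=> f0.
have /integrableP[mff _] := L2_mul_integrable f f.
have : (\int[mu]_x `|(f x * f x)%:E| = 0)%E.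
  transitivity (dot f f)%:E; last by rewrite f0.
  rewrite /dot /Rintegral fineK; last exact: integrable_fin_num (L2_mul_integrable f f).
  by apply: eq_integral => x _; rewrite gee0_abs// lee_fin -expr2 sqr_ge0.
move/(ae_eq_integral_abs mu measurableT mff); apply: filterS => x /(_ I) /= [].
by move/eqP; rewrite mulf_eq0 orbb => /eqP ->.
Qed.

Lemma aeq_dotl f g h : aeq f g -> dot f h = dot g h.
Proof.
move=> fg; congr fine; apply: ae_eq_integral => //=.
- by case/integrableP: (L2_mul_integrable f h).
- by case/integrableP: (L2_mul_integrable g h).
- by apply: filterS fg => x -> _.
Qed.

(** Testing against [f - g] gives the converse direction. Almost-everywhere identities thereby
    reduce to bilinear algebra on [dot]. *)
Lemma aeqP f g : aeq f g <-> forall h, dot f h = dot g h.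
Proof.
split=> [fg h|fg]; first exact: aeq_dotl.
have /dotff_eq0 : dot (f - g) (f - g) = 0 by rewrite dotBl fg subrr.
by apply: filterS => x /= /eqP; rewrite subr_eq0 => /eqP.
Qed.

Lemma aeq_dot f g f' g' : aeq f f' -> aeq g g' -> dot f g = dot f' g'.
Proof. by move=> /aeqP-> /aeqP E; rewrite dotC E dotC. Qed.

Lemma aeqxx f : aeq f f. Proof. exact/aeqP. Qed.

Lemma aeq_sym f g : aeq f g -> aeq g f.
Proof. by move=> /aeqP fg; apply/aeqP => h; rewrite fg. Qed.

Lemma aeq_trans g f h : aeq f g -> aeq g h -> aeq f h.
Proof. by move=> /aeqP fg /aeqP gh; apply/aeqP => k; rewrite fg. Qed.

Lemma aeq_lincomb a f g f' g' :
  aeq f f' -> aeq g g' -> aeq (a *: f + g) (a *: f' + g').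
Proof.
by move=> /aeqP ff /aeqP gg; apply/aeqP => h; rewrite !dotE ff gg.
Qed.

Lemma aeq_nrm f g : aeq f g -> nrm f = nrm g.
Proof. by move=> fg; rewrite /nrm (aeq_dot fg fg). Qed.

Lemma nrm0_aeq f : nrm f = 0 -> aeq f 0.
Proof. by move=> f0; apply: dotff_eq0; rewrite -sqr_nrm f0 expr0n. Qed.

Lemma nrm0 : nrm (0 : L2 mu) = 0.
Proof. by rewrite /nrm dot0l sqrtr0. Qed.

Lemma nrmZ a f : nrm (a *: f) = `|a| * nrm f.
Proof.
by rewrite /nrm !dotE mulrA -expr2 sqrtrM ?sqr_ge0// sqrtr_sqr.
Qed.

Lemma nrmN f : nrm (- f) = nrm f.
Proof. by rewrite -scaleN1r nrmZ normrN1 mul1r. Qed.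

Lemma cauchy_schwarz f g : `|dot f g| <= nrm f * nrm g.
Proof.
rewrite -(ler_pXn2r (ltn0Sn 1)) ?nnegrE ?mulr_ge0 ?nrm_ge0//.
rewrite exprMn !sqr_nrm real_normK ?num_real//.
have [/dotff_eq0 g0|g0] := eqVneq (dot g g) 0.
  by rewrite dotC (aeq_dotl f g0) dot0l expr0n mulr_ge0 ?dot_ge0.
have gg : 0 < dot g g by rewrite lt_neqAle eq_sym g0 dot_ge0.
(* The squared norm of this vector is [dot g g] times [dot f f * dot g g - dot f g ^+ 2]. *)
have := dot_ge0 (dot g g *: f - dot f g *: g).
rewrite !dotE (dotC g f) => H.
rewrite -subr_ge0 -(pmulr_rge0 _ gg); apply: le_trans H _.
by rewrite le_eqVlt; apply/orP; left; apply/eqP; ring.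
Qed.

Lemma dot_le f g : dot f g <= nrm f * nrm g.
Proof. exact: le_trans (ler_norm _) (cauchy_schwarz f g). Qed.

Lemma nrmD f g : nrm (f + g) <= nrm f + nrm g.
Proof.
rewrite -(ler_pXn2r (ltn0Sn 1)) ?nnegrE ?addr_ge0 ?nrm_ge0//.
rewrite sqrrD !sqr_nrm !dotE (dotC g f).
by have := dot_le f g; lra.
Qed.

Lemma nrmB f g : nrm (f - g) = nrm (g - f).
Proof. by rewrite -nrmN opprB. Qed.

Lemma nrm_le_dist f g : nrm f <= nrm (f - g) + nrm g.
Proof. by rewrite -{1}(subrK g f) nrmD. Qed.

Lemma meanE f : mean f = dot f (L2cst 1).
Proof. by apply: eq_Rintegral => x _; rewrite /= mulr1. Qed.

Lemma dot_one : dot (L2cst 1) (L2cst 1 : L2 mu) = 1.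
Proof.
rewrite /dot; under eq_Rintegral do rewrite /= mulr1.
rewrite (Rintegral_cst mu measurableT) mul1r.
by have := probability_setT mu => /(congr1 fine).
Qed.

Lemma Pi0E f : Pi0 f = f - dot f (L2cst 1) *: L2cst 1.
Proof. by rewrite /Pi0 meanE. Qed.

End L2_calculus.

(** * Orthonormal bases and orthogonal projectors of finite-dimensional subspaces *)

Section finite_dimensional_subspaces.
Local Set Implicit Arguments.
Local Unset Strict Implicit.
Context (d : measure_display) (T : measurableType d) (R : realType).
Context (mu : probability T R).
Implicit Types (f g h : L2 mu) (a : R) (W : set (L2 mu)).

Lemma finite_dim_aeq W f g :
  finite_dim_subspace W -> aeq f g -> W f -> W g.
Proof.
move=> [n [b ->]] fg [c fc]; exists c.
exact: aeq_trans (aeq_sym fg) fc.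
Qed.

Lemma finite_dim_lincomb W a f g :
  finite_dim_subspace W -> W f -> W g -> W (a *: f + g).
Proof.
move=> [n [b ->]] [c fc] [c' gc]; exists (fun i => a * c i + c' i).
apply: aeq_trans (aeq_lincomb a fc gc) _.
rewrite scaler_sumr -big_split /=; apply/aeqP => h; congr (dot _ h).
by apply: eq_bigr => i _; rewrite scalerA scalerDl.
Qed.

Lemma finite_dim0 W : finite_dim_subspace W -> W 0.
Proof.
move=> [n [b ->]]; exists (fun=> 0); rewrite big1 => [|i _]; last exact: scale0r.
exact: aeqxx.
Qed.

Lemma finite_dimZ W a f : finite_dim_subspace W -> W f -> W (a *: f).
Proof.
by move=> fW Wf; rewrite -[_ *: _]addr0; apply: finite_dim_lincomb (finite_dim0 fW).
Qed.

Lemma finite_dimB W f g : finite_dim_subspace W -> W f -> W g -> W (f - g).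
Proof.
by move=> fW Wf Wg; rewrite addrC -scaleN1r; exact: finite_dim_lincomb.
Qed.

Definition orthonormal n (e : 'I_n -> L2 mu) :=
  forall i j, dot (e i) (e j) = (i == j)%:R.

(** For orthonormal [e] this is the orthogonal projection onto the span of [e], and the span
    consists of its fixed points up to [aeq]. *)
Definition fourier n (e : 'I_n -> L2 mu) f : L2 mu :=
  \sum_i dot f (e i) *: e i.

Lemma dot_fourier n (e : 'I_n -> L2 mu) f h :
  dot (fourier e f) h = \sum_i dot f (e i) * dot (e i) h.
Proof. by rewrite dot_suml; apply: eq_bigr => i _; rewrite dotZl. Qed.

Lemma dot_fourierC n (e : 'I_n -> L2 mu) f h :
  dot (fourier e f) h = dot f (fourier e h).
Proof.
rewrite dot_fourier [RHS]dotC dot_fourier; apply: eq_bigr => i _.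
by rewrite mulrC (dotC (e i) h) (dotC (e i) f).
Qed.

Lemma dot_orthonormal_sum n (e : 'I_n -> L2 mu) (c : 'I_n -> R) j :
  orthonormal e -> dot (\sum_i c i *: e i) (e j) = c j.
Proof.
move=> oe; rewrite dot_suml (bigD1 j)//= dotZl oe eqxx mulr1 big1 ?addr0// => i ij.
by rewrite dotZl oe (negPf ij) mulr0.
Qed.

Lemma dot_fourier_basis n (e : 'I_n -> L2 mu) f j :
  orthonormal e -> dot (fourier e f) (e j) = dot f (e j).
Proof. exact: dot_orthonormal_sum. Qed.

Lemma fourierK n (e : 'I_n -> L2 mu) f :
  orthonormal e -> fourier e (fourier e f) = fourier e f.
Proof. by move=> oe; apply: eq_bigr => i _; rewrite dot_fourier_basis. Qed.

Lemma fourier_lincomb n (e : 'I_n -> L2 mu) a f g :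
  fourier e (a *: f + g) = a *: fourier e f + fourier e g.
Proof.
rewrite /fourier scaler_sumr -big_split; apply: eq_bigr => i _ /=.
by rewrite dotDl dotZl scalerDl scalerA.
Qed.

(** Induction on [n]: take an orthonormal system [e] for the tail and the residual [r] of the head
    after projection. If [r] vanishes almost everywhere, the head already lies in the span of [e];
    otherwise [r] is normalised and added. As [b] may be linearly dependent, [k] need not equal
    [n]. *)
Lemma gram_schmidt n (b : 'I_n -> L2 mu) :
  exists k (e : 'I_k -> L2 mu), orthonormal e /\
    forall f, (exists c : 'I_n -> R, aeq f (\sum_i c i *: b i)) <->
      aeq f (fourier e f).
Proof.
elim: n b => [b|n IHn b].
  exists 0%N, b; split=> [i|f]; first by case: i.
  split=> [[c]|]; first by rewrite /fourier !big_ord0.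
  by move=> fb; exists (fun=> 0); move: fb; rewrite /fourier !big_ord0.
have [k [e [oe IH]]] := IHn (fun i => b (lift ord0 i)).
have spanE c : \sum_(i < n.+1) c i *: b i =
    c ord0 *: b ord0 + \sum_(i < n) c (lift ord0 i) *: b (lift ord0 i).
  by rewrite big_ord_recl.
have spanI f a f' : aeq f (a *: b ord0 + f') -> aeq f' (fourier e f') ->
    exists c : 'I_n.+1 -> R, aeq f (\sum_i c i *: b i).
  move=> ff' /IH[c f'c]; exists (fun i => oapp c a (unlift ord0 i)).
  apply: aeq_trans ff' _; rewrite spanE unlift_none /=.
  by under eq_bigr do rewrite liftK /=; apply: aeq_lincomb f'c; exact: aeqxx.
have [r rE] : exists r, r = b ord0 - fourier e (b ord0) by eexists.
have re i : dot r (e i) = 0 by rewrite rE dotBl dot_fourier_basis// subrr.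
have ror f : dot r (fourier e f) = 0.
  rewrite dotC dot_fourier big1// => i _; by rewrite (dotC _ r) re mulr0.
have [r0|r0] := eqVneq (dot r r) 0.
  have b0e : aeq (b ord0) (fourier e (b ord0)).
    apply/aeqP => h; have /dotff_eq0 /aeqP /(_ h) := r0.
    by rewrite dot0l rE dotBl => /eqP; rewrite subr_eq0 => /eqP.
  exists k, e; split=> // f; split=> [[c fc]|fe].
    have : aeq (\sum_i c i *: b i) (fourier e (\sum_i c i *: b i)).
      rewrite spanE fourier_lincomb; apply: aeq_lincomb => //; apply/IH.
      by exists (fun i => c (lift ord0 i)); exact: aeqxx.
    move=> H; apply/aeqP => h; rewrite (aeq_dotl _ fc) (aeq_dotl _ H).
    by rewrite !dot_fourierC (aeq_dotl _ fc).
  by apply: (spanI f 0 f) => //; rewrite scale0r add0r; exact: aeqxx.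
have nr0 : nrm r != 0 by apply: contra r0 => /eqP nr0; rewrite -sqr_nrm nr0 expr0n.
pose e' i := oapp e ((nrm r)^-1 *: r) (unlift ord0 i).
have e'0 : e' ord0 = (nrm r)^-1 *: r by rewrite /e' unlift_none.
have e'S i : e' (lift ord0 i) = e i by rewrite /e' liftK.
have fourier'E f : fourier e' f = (dot f r / dot r r) *: r + fourier e f.
  have head : dot f (e' ord0) *: e' ord0 = (dot f r / dot r r) *: r.
    rewrite e'0 dotZr scalerA; congr (_ *: r).
    by rewrite mulrC mulrA -expr2 exprVn (sqr_nrm r) mulrC.
  rewrite /fourier (big_ord_recl k (fun i => dot f (e' i) *: e' i)) head.
  by under eq_bigr do rewrite e'S.
exists k.+1, e'; split.
  move=> i j; case: (unliftP ord0 i) => [i'|] ->; case: (unliftP ord0 j) => [j'|] ->.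
  - by rewrite !e'S oe (inj_eq lift_inj).
  - by rewrite e'S e'0 dotZr dotC re mulr0 eq_sym (negPf (neq_lift _ _)).
  - by rewrite e'S e'0 dotZl re mulr0 (negPf (neq_lift _ _)).
  - by rewrite e'0 !dotE -(sqr_nrm r) eqxx expr2 mulKf// mulVf.
move=> f; split=> [[c fc]|].
  have fixr f' : aeq f' (fourier e f') -> aeq f' (fourier e' f').
    move=> f'e; rewrite fourier'E (aeq_dotl _ f'e) dotC ror mul0r scale0r add0r//.
  have b0r : dot (b ord0) r = dot r r.
    by rewrite {2}rE dotBl (dotC (fourier _ _)) ror subr0.
  have b0e' : aeq (b ord0) (fourier e' (b ord0)).
    by rewrite fourier'E b0r divff// scale1r rE subrK; exact: aeqxx.
  have H : aeq (\sum_i c i *: b i) (fourier e' (\sum_i c i *: b i)).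
    rewrite spanE fourier_lincomb; apply: aeq_lincomb => //; apply/fixr/IH.
    by exists (fun i => c (lift ord0 i)); exact: aeqxx.
  apply/aeqP => h; rewrite (aeq_dotl _ fc) (aeq_dotl _ H).
  by rewrite !dot_fourierC (aeq_dotl _ fc).
rewrite fourier'E; set a := _ / _ => fe'.
(* Write [P] for [fourier e]. Since [r = b ord0 - P (b ord0)], the expansion [a r + P f] equals
   [a b ord0 + P (f - a b ord0)]. *)
apply: (spanI f a (fourier e (- a *: b ord0 + f))); last first.
  by rewrite fourierK//; exact: aeqxx.
apply: aeq_trans fe' _; rewrite fourier_lincomb rE scalerBr scaleNr addrA.
exact: aeqxx.
Qed.

Lemma finite_dim_basis W : finite_dim_subspace W ->
  exists k (e : 'I_k -> L2 mu),
    orthonormal e /\ forall f, W f <-> aeq f (fourier e f).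
Proof.
by move=> [n [b ->]]; have [k [e [oe H]]] := gram_schmidt b; exists k, e.
Qed.

(** The Fourier expansion in an orthonormal basis satisfies the defining conditions, so the [xget]
    in [orth_proj] does not fall back to its default 0. *)
Lemma orth_projP W f : finite_dim_subspace W ->
  W (orth_proj W f) /\ forall h, W h -> dot (orth_proj W f) h = dot f h.
Proof.
move=> fW; have [k [e [oe We]]] := finite_dim_basis fW.
have : exists g, W g /\ forall h, W h -> dot (f - g) h = 0.
  exists (fourier e f); split; first by apply/We; rewrite fourierK//; exact: aeqxx.
  move=> h /We he; rewrite dotBl dot_fourierC (dotC f h) (aeq_dotl f he).
  by rewrite (dotC _ f) subrr.
move=> [g Hg]; have [Wp Hp] : [set g | W g /\ forall h, W h -> dot (f - g) h = 0]
  (orth_proj W f) by rewrite /orth_proj; case: xgetP => [y -> //|/(_ g)].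
split=> // h /Hp /eqP; rewrite dotBl subr_eq0 => /eqP ->//.
Qed.

Section projector.
Variable W : set (L2 mu).
Hypothesis fW : finite_dim_subspace W.

Lemma orth_proj_in f : W (orth_proj W f).
Proof. by have [] := orth_projP f fW. Qed.

Lemma dot_orth_proj f h : W h -> dot (orth_proj W f) h = dot f h.
Proof. by have [_ H] := orth_projP f fW; exact: H. Qed.

End projector.

End finite_dimensional_subspaces.

(** * Inversion in finite dimension, closures of graphs, and hypocoercivity on a closure *)

Section graphs.
Local Set Implicit Arguments.
Local Unset Strict Implicit.
Context (d : measure_display) (T : measurableType d) (R : realType).
Context (mu : probability T R).
Implicit Types (f g h : L2 mu) (a : R) (W : set (L2 mu)).
Implicit Types S : set (L2 mu * L2 mu).

(** In an orthonormal basis of [W], [B] is a square matrix [M] acting on coordinate rows from the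
    right. Injectivity of [B] makes [M] row free, hence invertible, and the coordinates of the
    preimage come from [invmx M]. *)
Lemma injective_invertible_on W (B : L2 mu -> L2 mu) :
  finite_dim_subspace W -> (forall f, W f -> W (B f)) ->
  (forall f g, W f -> aeq f g -> aeq (B f) (B g)) ->
  (forall a f g, W f -> W g -> aeq (B (a *: f + g)) (a *: B f + B g)) ->
  (forall f, W f -> aeq (B f) 0 -> aeq f 0) -> invertible_on W B.
Proof.
move=> fW WB Bae Blin Binj; split=> // g Wg.
have [n [e [oe We]]] := finite_dim_basis fW.
have Wei i : W (e i).
  apply/We; rewrite /fourier (bigD1 i)//= oe eqxx scale1r big1 ?addr0.
    exact: aeqxx.
  by move=> j ji; rewrite oe eq_sym (negPf ji) scale0r.
have B0 : aeq (B 0) 0.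
  have /aeqP W0 := Blin (-1) 0 0 (finite_dim0 fW) (finite_dim0 fW).
  apply/aeqP => h; have := W0 h.
  by rewrite scaler0 addr0 dotDl dotZl mulN1r addNr dot0l.
have Bsum (c : 'I_n -> R) : W (\sum_i c i *: e i) /\
    forall h, dot (B (\sum_i c i *: e i)) h = \sum_i c i * dot (B (e i)) h.
  elim: (index_enum _) => [|i s [Ws IHs]].
    rewrite big_nil; split=> [|h]; first exact: finite_dim0.
    by rewrite big_nil (aeq_dotl h B0) dot0l.
  rewrite big_cons; split=> [|h]; first exact: finite_dim_lincomb.
  by rewrite (aeq_dotl h (Blin _ _ _ (Wei i) Ws)) big_cons dotDl dotZl IHs.
pose M := \matrix_(i < n, j < n) dot (B (e i)) (e j).
have BM (c : 'rV_n) j :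
    dot (B (\sum_i c ord0 i *: e i)) (e j) = (c *m M) ord0 j.
  rewrite (Bsum (c ord0)).2 !mxE; apply: eq_bigr => i _; by rewrite !mxE.
have coordE f f' : W f -> W f' -> (forall j, dot f (e j) = dot f' (e j)) ->
    aeq f f'.
  move=> /We fe /We fe' ff'; apply: aeq_trans fe _; apply: aeq_trans (aeq_sym fe').
  by rewrite /fourier; under eq_bigr do rewrite ff'; exact: aeqxx.
have Mu : M \in unitmx.
  rewrite -row_free_unit; apply: inj_row_free => c cM0.
  have [Wc _] := Bsum (c ord0).
  have /(Binj _ Wc) c0 : aeq (B (\sum_i c ord0 i *: e i)) 0.
    apply: coordE; [exact: WB|exact: finite_dim0|move=> j].
    by rewrite BM cM0 mxE dot0l.
  apply/rowP => i; rewrite mxE -(dot_orthonormal_sum (c ord0) i oe).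
  by rewrite (aeq_dotl _ c0) dot0l.
pose c := (\row_j dot g (e j)) *m invmx M.
exists (\sum_i c ord0 i *: e i).
  split; first by have [] := Bsum (c ord0).
  apply: coordE => //; first by apply: WB; have [] := Bsum (c ord0).
  by move=> j; rewrite BM mulmxKV// mxE.
have [Wc _] := Bsum (c ord0).
have Bc : aeq (B (\sum_i c ord0 i *: e i)) g.
  by apply: coordE => [||j]; [exact: WB|by []|rewrite BM mulmxKV// mxE].
move=> f Wf Bf; have /(Binj _ _) /aeqP fc : aeq (B (f - \sum_i c ord0 i *: e i)) 0.
  rewrite addrC -scaleN1r; apply: aeq_trans (Blin _ _ _ Wc Wf) _.
  apply: aeq_trans (aeq_lincomb (-1) Bc Bf) _.
  by rewrite scaleN1r addNr; exact: aeqxx.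
apply/aeqP => h; apply/eqP; rewrite -subr_eq0 -dotBl fc ?dot0l//.
exact: finite_dimB.
Qed.

Lemma rel_closure_aeq S f g f' g' :
  aeq f f' -> aeq g g' -> rel_closure S (f, g) -> rel_closure S (f', g').
Proof.
move=> ff' gg' Sfg e e0; have [uv [Suv uf vg]] := Sfg e e0; exists uv.
have sub_aeq (u k k' : L2 mu) : aeq k k' -> aeq (u - k') (u - k).
  by move=> /aeqP kk'; apply/aeqP => h; rewrite !dotBl kk'.
by split; rewrite //= ?(aeq_nrm (sub_aeq _ _ _ ff')) ?(aeq_nrm (sub_aeq _ _ _ gg')).
Qed.

Definition rel_linear S := forall a z w, S z -> S w ->
  S (a *: z.1 + w.1, a *: z.2 + w.2).

Lemma rel_closure_linear S : rel_linear S -> rel_linear (rel_closure S).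
Proof.
move=> linS a [f g] [f' g'] Sfg Sfg' e e0.
(* With tolerance [t = e / (|a| + 1)] for both pairs, the combined error is below
   [|a| t + t = e]. *)
have a1 : 0 < `|a| + 1 by rewrite ltr_wpDl.
have [uv [Suv uf vg]] := Sfg _ (divr_gt0 e0 a1).
have [uv' [Suv' uf' vg']] := Sfg' _ (divr_gt0 e0 a1).
exists (a *: uv.1 + uv'.1, a *: uv.2 + uv'.2).
have lincomb_lt (u k u' k' : L2 mu) :
    nrm (u - k) < e / (`|a| + 1) -> nrm (u' - k') < e / (`|a| + 1) ->
    nrm (a *: u + u' - (a *: k + k')) < e.
  move=> uk uk'; rewrite opprD addrACA -scalerBr.
  apply: le_lt_trans (nrmD _ _) _; rewrite nrmZ.
  have -> : e = `|a| * (e / (`|a| + 1)) + e / (`|a| + 1).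
    by rewrite -[X in _ + X]mul1r -mulrDl mulrC divfK ?gt_eqF.
  by apply: ler_ltD => //; rewrite ler_wpM2l// ltW.
by split; [exact: linS|exact: lincomb_lt|exact: lincomb_lt].
Qed.

Lemma squeeze_cvg0 (x y : nat -> R) :
  (forall n, 0 <= x n <= y n) -> y @ \oo --> 0 -> x @ \oo --> 0.
Proof.
move=> xy; apply: (squeeze_cvgr _ (cvg_cst 0)).
by near=> n; exact: xy.
Unshelve. all: by end_near. Qed.

(** Tolerances [1 / (n + 1)] turn the closure into sequences, so that inequalities can be passed to
    the limit. *)
Lemma rel_closure_seq S f g : rel_closure S (f, g) ->
  exists uv : nat -> L2 mu * L2 mu, [/\ forall n, S (uv n),
    (fun n => nrm ((uv n).1 - f)) @ \oo --> 0 &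
    (fun n => nrm ((uv n).2 - g)) @ \oo --> 0].
Proof.
move=> Sfg; pose e (n : nat) : R := n.+1%:R^-1.
have e0 n : 0 < e n by rewrite invr_gt0.
have /choice[uv Huv] : forall n, exists uv,
  [/\ S uv, nrm (uv.1 - f) < e n & nrm (uv.2 - g) < e n].
  by move=> n; exact: Sfg.
have cvg0 (x : nat -> L2 mu) : (forall n, nrm (x n) < e n) ->
    (fun n => nrm (x n)) @ \oo --> 0.
  move=> xe; apply: squeeze_cvg0 cvg_harmonic => n.
  by rewrite nrm_ge0 ltW.
exists uv; split=> [n||]; first by have [] := Huv n.
- by apply: cvg0 => n; have [] := Huv n.
- by apply: cvg0 => n; have [] := Huv n.
Qed.

Lemma cvg_dot (u v : nat -> L2 mu) f g :
  (fun n => nrm (u n - f)) @ \oo --> 0 -> (fun n => nrm (v n - g)) @ \oo --> 0 ->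
  (fun n => dot (u n) (v n)) @ \oo --> dot f g.
Proof.
move=> uf vg; apply/subr_cvg0; apply/norm_cvg0P.
apply: (@squeeze_cvg0 _
  (fun n => nrm (u n - f) * nrm (v n - g) + nrm (u n - f) * nrm g
    + nrm f * nrm (v n - g))) => [n|].
- rewrite normr_ge0 /=.
  have -> : dot (u n) (v n) - dot f g =
      dot (u n - f) (v n - g) + dot (u n - f) g + dot f (v n - g).
    by rewrite !dotE; ring.
  apply: le_trans (ler_normD _ _) _; apply: lerD; last exact: cauchy_schwarz.
  by apply: le_trans (ler_normD _ _) _; apply: lerD; exact: cauchy_schwarz.
- rewrite [X in _ --> X](_ : _ = 0 * 0 + 0 * nrm g + nrm f * 0); last by ring.
  apply: cvgD; [apply: cvgD|]; apply: cvgM => //; exact: cvg_cst.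
Qed.

(** Serves to carry the bound of [resolvent_nrm_le] over to [A], whose graph is a closure. The
    tolerance [t = e / (k + 1)] is chosen so that [t + k t = e]. *)
Lemma rel_closure_nrm_le S (k : R) : 0 <= k ->
  (forall z, S z -> nrm z.2 <= k * nrm z.1) ->
  forall f g, rel_closure S (f, g) -> nrm g <= k * nrm f.
Proof.
move=> k0 Sk f g Sfg; apply/ler_addgt0Pr => e e0.
have k1 : 0 < k + 1 by rewrite ltr_wpDl.
have [uv [/Sk Suv uf vg]] := Sfg _ (divr_gt0 e0 k1).
have -> : e = e / (k + 1) + k * (e / (k + 1)).
  by rewrite -[X in X + _]mul1r -mulrDl [1 + k]addrC mulrC divfK ?gt_eqF.
have := nrm_le_dist g uv.2; have := nrm_le_dist uv.1 f; rewrite (nrmB g).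
move=> uf' vg'; move: uf vg => /= uf vg.
have : k * nrm uv.1 <= k * (e / (k + 1) + nrm f).
  by rewrite ler_wpM2l//; lra.
by rewrite mulrDr; lra.
Qed.

(* If [h = (1 + S^*S)^-1 S^* f] then [|h|^2 + |S h|^2 = <S h, f>]. *)
Lemma resolvent_nrm_le S f h :
  rel_comp (rel_inv (rel_add1 (rel_comp (rel_adjoint S) S))) (rel_adjoint S)
    (f, h) -> nrm h <= 2^-1 * nrm f.
Proof.
case=> /= g adj_fg [/= k [/= w Shw adj_wk] gE].
have /= wf := adj_fg _ Shw; have /= ww := adj_wk _ Shw.
move: wf; rewrite dotC (dotC h g) (aeq_dotl h gE) dotDl (dotC k) -ww => wf.
rewrite -(ler_pXn2r (ltn0Sn 1)) ?nnegrE ?mulr_ge0 ?nrm_ge0//.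
have := dot_le f w; rewrite wf -(sqr_nrm h) -(sqr_nrm w) => H.
(* Completing the square, [|f| |w| - |w|^2 <= |f|^2 / 4]; this is where the constant 1/2 comes
   from. *)
by have := sqr_ge0 (nrm w - 2^-1 * nrm f); nra.
Qed.

(** [A] is a bare function; moving it to the other side of [dot] shows that the existence of an
    adjoint forces linearity. *)
Lemma adjoint_linear (A Astar : L2 mu -> L2 mu) :
  (forall f g, dot (A f) g = dot f (Astar g)) ->
  forall a f g, aeq (A (a *: f + g)) (a *: A f + A g).
Proof.
by move=> AA a f g; apply/aeqP => h; rewrite AA !dotDl !dotZl !AA.
Qed.

Lemma nrm_Pi0_le f : nrm (Pi0 f) <= nrm f.
Proof.
rewrite -(ler_pXn2r (ltn0Sn 1)) ?nnegrE ?nrm_ge0// !sqr_nrm Pi0E.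
rewrite !dotE dot_one (dotC (L2cst 1)).
by have := sqr_ge0 (dot f (L2cst 1)); lra.
Qed.

Lemma Pi0B f g : aeq (Pi0 f - Pi0 g) (Pi0 (f - g)).
Proof. by apply/aeqP => h; rewrite !Pi0E !dotE; ring. Qed.

(** Here [g] is the image of [f], which is also that of [Pi0 f] because the generator kills
    constants. The inequality can then be stated on pairs of a graph. *)
Definition hypocoercive (A : L2 mu -> L2 mu) (lamt eps : R) S :=
  forall f g, S (f, g) ->
    lamt * nrm (Pi0 f) ^+ 2 <=
      dot (- g) (Pi0 f) + eps * dot (A g) (Pi0 f) + eps * dot (A (Pi0 f)) g.

(** As [A] and [Pi0] are bounded, both sides are continuous in the pair [(f, g)] for the L^2 norm of
    each component. *)
Lemma hypocoercive_closure (A : L2 mu -> L2 mu) (k lamt eps : R) S :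
  (forall a f g, aeq (A (a *: f + g)) (a *: A f + A g)) ->
  (forall f, nrm (A f) <= k * nrm f) ->
  hypocoercive A lamt eps S -> hypocoercive A lamt eps (rel_closure S).
Proof.
move=> Alin Abnd Scoer f g Sfg.
have [uv [Suv uf vg]] := rel_closure_seq Sfg.
have Acvg (x : nat -> L2 mu) y : (fun n => nrm (x n - y)) @ \oo --> 0 ->
    (fun n => nrm (A (x n) - A y)) @ \oo --> 0.
  move=> xy; apply: (@squeeze_cvg0 _ (fun n => k * nrm (x n - y))) => [n|].
  - rewrite nrm_ge0 (_ : nrm (A (x n) - A y) = nrm (A (x n - y))) ?Abnd//.
    by rewrite [x n - y]addrC -(scaleN1r y) (aeq_nrm (Alin _ _ _)) scaleN1r addrC.
  - by rewrite -[X in _ --> X](mulr0 k); apply: cvgM => //; exact: cvg_cst.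
have Pcvg : (fun n => nrm (Pi0 (uv n).1 - Pi0 f)) @ \oo --> 0.
  apply: squeeze_cvg0 uf => n.
  by rewrite nrm_ge0 (aeq_nrm (Pi0B _ _)) nrm_Pi0_le.
have Ncvg : (fun n => nrm (- (uv n).2 - - g)) @ \oo --> 0.
  by under eq_fun do rewrite -opprD nrmN.
have rhs : (fun n => dot (- (uv n).2) (Pi0 (uv n).1) +
      eps * dot (A (uv n).2) (Pi0 (uv n).1) +
      eps * dot (A (Pi0 (uv n).1)) (uv n).2) @ \oo -->
    dot (- g) (Pi0 f) + eps * dot (A g) (Pi0 f) + eps * dot (A (Pi0 f)) g.
  apply: cvgD; [apply: cvgD; first exact: cvg_dot|]; apply: cvgM.
  - exact: cvg_cst.
  - by apply: cvg_dot => //; exact: Acvg.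
  - exact: cvg_cst.
  - by apply: cvg_dot => //; exact: Acvg.
have lhs : (fun n => lamt * dot (Pi0 (uv n).1) (Pi0 (uv n).1)) @ \oo -->
    lamt * dot (Pi0 f) (Pi0 f).
  by apply: cvgM; [exact: cvg_cst|exact: cvg_dot].
rewrite sqr_nrm; apply: (ler_cvg_to lhs rhs).
near=> n; have := Suv n; rewrite (surjective_pairing (uv n)) => /Scoer.
by rewrite sqr_nrm.
Unshelve. all: by end_near. Qed.

Section closed_operator.
Variables (L : operator mu) (S : set (L2 mu * L2 mu)).
Hypotheses (linS : rel_linear S) (LS : graph L = rel_closure S).

Lemma dom_graph f : dom L f -> rel_closure S (f, L f).
Proof. by move=> df; rewrite -LS; split=> //=; exact: aeqxx. Qed.

(** A closure is invariant under [aeq] in both components, while a pair in the graph of an operator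
    has its second component determined up to [aeq]. *)
Lemma op_aeq f g : dom L f -> aeq f g -> aeq (L f) (L g).
Proof.
move=> /dom_graph df fg; have : graph L (g, L f).
  by rewrite LS; exact: rel_closure_aeq fg (aeqxx _) df.
by case.
Qed.

Lemma op_lincomb a f g : dom L f -> dom L g ->
  aeq (L (a *: f + g)) (a *: L f + L g).
Proof.
move=> /dom_graph df /dom_graph dg.
have : graph L (a *: f + g, a *: L f + L g).
  by rewrite LS; exact: (rel_closure_linear linS) df dg.
by case=> _ /= /aeq_sym.
Qed.

End closed_operator.
End graphs.

(** * Linearity of the Langevin operator on test functions and its invariance under adding
    constants *)

Section generator_core.
Local Set Implicit Arguments.
Local Unset Strict Implicit.

Lemma derive_lincomb (R : realType) (U : normedModType R) (f g : U -> R) (a : R)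
    (v : U) :
  (forall x, derivable f x v) -> (forall x, derivable g x v) ->
  'D_v (fun x => a * f x + g x) = (fun x => a * 'D_v f x + 'D_v g x).
Proof.
move=> df dg; apply/funext => x.
have -> : (fun x => a * f x + g x) = a *: f + g by [].
by rewrite deriveD ?deriveZ//; exact: derivableZ.
Qed.

Lemma Ck_lincomb (R : realType) (U : normedModType R) k (f g : U -> R) (a : R) :
  Ck k f -> Ck k g -> Ck k (fun x => a * f x + g x).
Proof.
elim: k f g => [|k IHk] f g [cf Df] [cg Dg]; (split; first by
  move=> x; apply: cvgD; [apply: cvgM; [exact: cvg_cst|exact: cf]|exact: cg]) => //.
move=> v; have [df Cf] := Df v; have [dg Cg] := Dg v.
split=> [x|]; last by rewrite derive_lincomb//; exact: IHk.
have -> : (fun x => a * f x + g x) = a *: f + g by [].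
by apply: derivableD => //; exact: derivableZ.
Qed.

(** The constant cancels inside the difference quotient, so the two limits agree even when they take
    a default value. *)
Lemma derive_addcst (R : realType) (U : normedModType R) (f : U -> R) (c : R)
    (v : U) :
  'D_v (fun x => f x + c) = 'D_v f.
Proof.
apply/funext => x; rewrite /derive.
by under eq_fun do rewrite opprD addrACA subrr addr0.
Qed.

Context (R : realType) (D : nat) (X : position_space R).
Context (V : 'rV[R]_D -> R) (beta m gamma : R).
Notation phase := ('rV[R]_D * 'rV[R]_D)%type.

Lemma test_phase_lincomb (f g : phase -> R) (a : R) :
  test_phase X f -> test_phase X g -> test_phase X (fun x => a * f x + g x).
Proof.
move=> [sf pf [K fK]] [sg pg [K' gK]]; split=> [k|p|].
- by apply: Ck_lincomb; [exact: sf|exact: sg].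
- move: (pf p) (pg p); rewrite /cell_periodic; case: X => // b pfp pgp q i.
  by rewrite pfp pgp.
- exists (Num.max K K') => x; have [fx0|/fK[bx px] _] := eqVneq (f x) 0.
    have [->|/gK[bx px] _] := eqVneq (g x) 0; first by rewrite fx0 mulr0 addr0 eqxx.
    split; last by rewrite (le_trans px)// le_max lexx orbT.
    by move: bx; rewrite /position_bounded; case: X => // bx;
       rewrite (le_trans bx)// le_max lexx orbT.
  split; last by rewrite (le_trans px)// le_max lexx.
  by move: bx; rewrite /position_bounded; case: X => // bx;
     rewrite (le_trans bx)// le_max lexx.
Qed.

Lemma langevin_lincomb (f g : phase -> R) (a : R) x : smooth f -> smooth g ->
  langevin V beta m gamma (fun x => a * f x + g x) x =
  a * langevin V beta m gamma f x + langevin V beta m gamma g x.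
Proof.
move=> sf sg; set F := (F in langevin _ _ _ _ F).
(* Order 2 suffices: the highest derivative in the operator is the Laplacian in [p]. *)
have [_ Df] := sf 2; have [_ Dg] := sg 2.
have EF v : 'D_v F = (fun y => a * 'D_v f y + 'D_v g y).
  by apply: derive_lincomb; [have [] := Df v|have [] := Dg v].
have E1 v y : derive F y v = a * derive f y v + derive g y v.
  exact: (congr1 (@^~ y) (EF v)).
have E2 v w y : derive ('D_v F) y w =
    a * derive ('D_v f) y w + derive ('D_v g) y w.
  have [_ [_ /(_ w) [dvf _]]] := Df v; have [_ [_ /(_ w) [dvg _]]] := Dg v.
  by rewrite EF; exact: (congr1 (@^~ y) (derive_lincomb a dvf dvg)).
have lincombB (p q b b' c c' : R) : p * (a * b + c) - q * (a * b' + c') =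
  a * (p * b - q * b') + (p * c - q * c') by ring.
have lincombD (p q b b' c c' : R) : p * (a * b + c) + q * (a * b' + c') =
  a * (p * b + q * b') + (p * c + q * c') by ring.
have hamE : Lham V m F x = a * Lham V m f x + Lham V m g x.
  rewrite /Lham mulr_sumr -big_split; apply: eq_bigr => i _ /=.
  rewrite /partial_q /partial_p /=.
  rewrite !E1.
  exact: lincombB.
have FDE : LFD beta m F x = a * LFD beta m f x + LFD beta m g x.
  rewrite /LFD mulr_sumr -big_split; apply: eq_bigr => i _ /=.
  rewrite /partial_p /=.
  rewrite E2 E1.
  exact: lincombD.
rewrite /langevin hamE FDE.
by rewrite mulrDr (mulrDr a) (mulrCA a) addrACA.
Qed.

Lemma langevin_addcst (f : phase -> R) (c : R) :
  langevin V beta m gamma (fun x => f x + c) = langevin V beta m gamma f.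
Proof.
set F := (F in langevin _ _ _ _ F).
have EF v : 'D_v F = 'D_v f := derive_addcst f c v.
have E1 v y : derive F y v = derive f y v := congr1 (@^~ y) (EF v).
have hamE x : Lham V m F x = Lham V m f x.
  by apply: eq_bigr => i _; rewrite /partial_q /partial_p /= !E1.
have FDE x : LFD beta m F x = LFD beta m f x.
  by apply: eq_bigr => i _; rewrite /partial_p /= E1 EF.
by apply/funext => x; rewrite /langevin hamE FDE.
Qed.

Lemma langevin_core_linear (mu : probability phase R) :
  rel_linear [set fg : L2 mu * L2 mu |
    test_phase X fg.1 /\ forall x, fg.2 x = langevin V beta m gamma fg.1 x].
Proof.
move=> a [f g] [f' g'] /= [tf fg] [tf' fg']; split.
  exact: (test_phase_lincomb a tf tf').
move=> x; have [[sf _ _] [sf' _ _]] := (tf, tf').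
have /= -> := langevin_lincomb a x sf sf'.
by rewrite -fg -fg'.
Qed.

(** [Pi0 f] differs from [f] by a constant. This converts the inequality assumed for [Pi0 f] into
    one on the pairs of the core. *)
Lemma langevin_Pi0 (mu : probability phase R) (f : L2 mu) :
  langevin V beta m gamma (Pi0 f) = langevin V beta m gamma f.
Proof.
rewrite -[RHS](langevin_addcst _ (- mean f)); congr langevin.
apply/funext => x; transitivity (f x - mean f * 1); first by [].
by rewrite mulr1.
Qed.

End generator_core.

(** * The Galerkin estimate: coercivity of the projected operator and the error bound *)

(* Stated for an abstract semi-inner product [ip]: on L^2 itself, unification
   would unfold [dot] down to the integrals.  [P] and [P0] are the orthogonal
   projectors onto [W] and onto the part of [W] orthogonal to [one]. *)
Section galerkin.
Local Set Implicit Arguments.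
Local Unset Strict Implicit.
Context (R : realType) (H : lmodType R).
Variables (ip : H -> H -> R) (nm : H -> R).
Implicit Types (f g h : H) (a : R).
Hypothesis ipC : forall f g, ip f g = ip g f.
Hypothesis ipDl : forall f g h, ip (f + g) h = ip f h + ip g h.
Hypothesis ipZl : forall a f h, ip (a *: f) h = a * ip f h.
Hypothesis nm_ge0 : forall f, 0 <= nm f.
Hypothesis nm_sqr : forall f, nm f ^+ 2 = ip f f.
Hypothesis ip_abs_le : forall f g, `|ip f g| <= nm f * nm g.

(** Equality modulo null vectors; for [dot] it is [aeq], by [aeqP]. *)
Definition ipeq f g := forall h, ip f h = ip g h.

Let ipDr f g h : ip h (f + g) = ip h f + ip h g.
Proof. by rewrite ipC ipDl !(ipC h). Qed.

Let ipZr a f h : ip h (a *: f) = a * ip h f.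
Proof. by rewrite ipC ipZl ipC. Qed.

Let ipNl f h : ip (- f) h = - ip f h.
Proof. by rewrite -scaleN1r ipZl mulN1r. Qed.

Let ipBl f g h : ip (f - g) h = ip f h - ip g h.
Proof. by rewrite ipDl ipNl. Qed.

Let ip_le f g : ip f g <= nm f * nm g.
Proof. exact: le_trans (ler_norm _) (ip_abs_le f g). Qed.

Let nm_le f (c : R) : 0 <= c -> ip f f <= c * nm f -> nm f <= c.
Proof.
move=> c0; have [->//|n0] := eqVneq (nm f) 0.
have n_gt0 : 0 < nm f by rewrite lt_neqAle eq_sym n0 nm_ge0.
by rewrite -nm_sqr expr2 ler_pM2r.
Qed.

Let ipeq_nm f g : ipeq f g -> nm f = nm g.
Proof.
move=> fg; apply/eqP; rewrite -(@eqrXn2 _ 2) ?nm_ge0// !nm_sqr.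
by rewrite fg ipC fg.
Qed.

Let nmD f g : nm (f + g) <= nm f + nm g.
Proof.
apply: nm_le; first by rewrite addr_ge0.
by rewrite ipDl mulrDl lerD.
Qed.

Let nmZ a f : nm (a *: f) = `|a| * nm f.
Proof.
apply/eqP; rewrite -(@eqrXn2 _ 2) ?mulr_ge0 ?nm_ge0//.
by rewrite exprMn real_normK ?num_real// !nm_sqr ipZl ipZr mulrA expr2.
Qed.

Let nmN f : nm (- f) = nm f.
Proof. by rewrite -scaleN1r nmZ normrN1 mul1r. Qed.

Let nm0_ipeq f : nm f = 0 -> ipeq f 0.
Proof.
move=> f0 h; rewrite -(scale0r 0) ipZl mul0r; apply/eqP; rewrite -normr_le0.
by apply: le_trans (ip_abs_le _ _) _; rewrite f0 mul0r.
Qed.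

Section projector.
Variables (W : set H) (P : H -> H).
Hypothesis W_lincomb : forall a f g, W f -> W g -> W (a *: f + g).
Hypothesis P_in : forall f, W (P f).
Hypothesis ip_P : forall f h, W h -> ip (P f) h = ip f h.

(** The difference [P f - g] lies in [W] and is orthogonal to [W], hence to itself. Identities for
    [P] and [P0] are checked below through this criterion. *)
Lemma proj_unique f g : W g -> (forall h, W h -> ip g h = ip f h) ->
  ipeq (P f) g.
Proof.
move=> Wg Hg h; apply/eqP; rewrite -subr_eq0 -ipBl nm0_ipeq; last first.
  have Wd : W (P f - g) by rewrite addrC -scaleN1r; exact: W_lincomb.
  by apply/eqP; rewrite -sqrf_eq0 nm_sqr ipBl ip_P// Hg// subrr.
by rewrite -(scale0r 0) ipZl mul0r.
Qed.

Lemma proj_id f : W f -> ipeq (P f) f.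
Proof. by move=> Wf; exact: proj_unique. Qed.

Lemma proj_ipeq f g : ipeq f g -> ipeq (P f) (P g).
Proof. by move=> fg; apply: proj_unique => // h Wh; rewrite ip_P. Qed.

Lemma proj_lincomb a f g : ipeq (P (a *: f + g)) (a *: P f + P g).
Proof.
apply: proj_unique => [|h Wh]; first exact: W_lincomb.
by rewrite !ipDl !ipZl !ip_P.
Qed.

Lemma nm_proj_le f : nm (P f) <= nm f.
Proof. by apply: nm_le => //; rewrite ip_P. Qed.

End projector.

Section bounded_adjoint.
Variables (A Astar : H -> H) (k : R).
Hypothesis A_adj : forall f g, ip (A f) g = ip f (Astar g).

Lemma adjoint_sym f g : ip (Astar f) g = ip f (A g).
Proof. by rewrite ipC -A_adj ipC. Qed.

(** Write [x = Astar f]; then [|x|^2 = ip (A x) f <= k |x| |f|], and one factor [|x|] cancels. *)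
Lemma nm_adjoint_le : 0 <= k -> (forall f, nm (A f) <= k * nm f) ->
  forall f, nm (Astar f) <= k * nm f.
Proof.
move=> k0 Ak f; apply: nm_le; first by rewrite mulr_ge0.
rewrite -A_adj; apply: le_trans (ip_le _ _) _.
by rewrite mulrAC ler_wpM2r.
Qed.

End bounded_adjoint.

Variables (domL : set H) (L Lstar A Astar : H -> H) (lamt eps : R).
Variables (W : set H) (one : H) (P P0 : H -> H).
Hypothesis L_ipeq : forall f g, domL f -> ipeq f g -> ipeq (L f) (L g).
Hypothesis L_lincomb : forall a f g, domL f -> domL g ->
  ipeq (L (a *: f + g)) (a *: L f + L g).
Hypothesis W_dom : W `<=` domL.
Hypothesis W_zero : W 0.
Hypothesis W_lincomb : forall a f g, W f -> W g -> W (a *: f + g).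
Hypothesis L_adj : forall f g, W f -> W g -> ip (L f) g = ip f (Lstar g).
Hypothesis A_adj : forall f g, ip (A f) g = ip f (Astar g).
Hypothesis A_le : forall f, nm (A f) <= 2^-1 * nm f.
Hypothesis eps_ge0 : 0 <= eps.
Let W0 := W `&` [set f | ip f one = 0].
Hypothesis L_coercive : forall f, W0 f ->
  lamt * nm f ^+ 2 <= ip (- L f) f + eps * ip (A (L f)) f + eps * ip (A f) (L f).
Hypothesis P_in : forall f, W (P f).
Hypothesis ip_P : forall f h, W h -> ip (P f) h = ip f h.
Hypothesis P0_in : forall f, W0 (P0 f).
Hypothesis ip_P0 : forall f h, W0 h -> ip (P0 f) h = ip f h.
Hypothesis Pone_neq0 : nm (P one) != 0.
Variable u : H.
Hypothesis uE : u = (nm (P one))^-1 *: P one.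
Let LM f := P0 (L (P0 f)).

Let W_scale a f : W f -> W (a *: f).
Proof. by move=> Wf; rewrite -[_ *: _]addr0; exact: W_lincomb. Qed.

Let W_u : W u.
Proof. by rewrite uE; exact: W_scale. Qed.

Let ip_uu : ip u u = 1.
Proof. by rewrite uE ipZl ipZr -nm_sqr expr2 mulKf// mulVf. Qed.

Let nm_u : nm u = 1.
Proof.
by apply/eqP; rewrite -(@eqrXn2 _ 2) ?nm_ge0 ?ler01// nm_sqr ip_uu expr1n.
Qed.

(** On [W], pairing with [P one] is pairing with [one]. So [W0] is the orthogonal complement of [u]
    in [W]. *)
Lemma ip_u f : W f -> ip f u = (nm (P one))^-1 * ip f one.
Proof. by move=> Wf; rewrite uE ipZr ipC ip_P// ipC. Qed.

Let W0_u f : W0 f -> ip f u = 0.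
Proof. by move=> [Wf f1]; rewrite ip_u// f1 mulr0. Qed.

Let W0_lincomb a f g : W0 f -> W0 g -> W0 (a *: f + g).
Proof.
move=> [Wf f1] [Wg g1]; split; first exact: W_lincomb.
by rewrite /= ipDl ipZl f1 g1 mulr0 addr0.
Qed.

Let W0_dom f : W0 f -> domL f.
Proof. by move=> [/W_dom]. Qed.

(** A test vector [h] of [W] splits into [h'] in [W0] and its component along the unit vector [u];
    the two sides agree on each. *)
Lemma proj_split f : ipeq (P f) (P0 f + ip f u *: u).
Proof.
apply: proj_unique (W_lincomb) P_in ip_P _ _ _ _.
  by rewrite addrC; apply: W_lincomb => //; case: (P0_in f).
move=> h Wh; pose h' := - ip h u *: u + h.
have W0h' : W0 h'.
  split; first exact: W_lincomb.
  have u1 : ip u one = nm (P one).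
    by rewrite uE ipZl ipC -ip_P// -nm_sqr expr2 mulKf.
  by rewrite /= /h' ipDl ipZl u1 ip_u// mulNr mulrAC mulVf// mul1r addNr.
have := ip_P0 f W0h'; rewrite /h' !ipDr !ipZr (W0_u (P0_in f)) ipDl ipZl (ipC u h).
by lra.
Qed.

Lemma LM_in f : W0 (LM f). Proof. exact: P0_in. Qed.

Let L_P0 f : W0 f -> ipeq (L (P0 f)) (L f).
Proof.
move=> Wf; apply: L_ipeq; first exact/W0_dom/P0_in.
exact: proj_id W0_lincomb P0_in ip_P0 _ Wf.
Qed.

Let ip_LM f h : W0 f -> W0 h -> ip (LM f) h = ip (L f) h.
Proof. by move=> Wf Wh; rewrite ip_P0// L_P0. Qed.

Lemma LM_ipeq f g : ipeq f g -> ipeq (LM f) (LM g).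
Proof.
move=> fg; apply: (proj_ipeq W0_lincomb P0_in ip_P0).
apply: L_ipeq; first exact/W0_dom/P0_in.
exact: (proj_ipeq W0_lincomb P0_in ip_P0).
Qed.

Lemma LM_lincomb a f g : W0 f -> W0 g ->
  ipeq (LM (a *: f + g)) (a *: LM f + LM g).
Proof.
move=> Wf Wg; apply: proj_unique W0_lincomb P0_in ip_P0 _ _ _ _.
  by apply: W0_lincomb; exact: LM_in.
move=> h Wh; rewrite ipDl ipZl !ip_LM// L_P0; last exact: W0_lincomb.
by rewrite L_lincomb ?ipDl ?ipZl//; exact: W0_dom.
Qed.

Let B f := A f + Astar f.
Variable delta : R.
Hypothesis delta_le : forall f, nm f <= 1 ->
  nm (B (L (P f) - P (L (P f)))) <= delta.
Let lamhat := (lamt - eps * (delta + nm (Lstar u))) / (1 + eps).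

Let LM_coercive_unit f : W0 f -> nm f = 1 -> lamhat <= nm (LM f).
Proof.
move=> W0f f1; have [Wf f0] := W0f; have df := W0_dom W0f.
have := L_coercive W0f; rewrite f1 expr1n mulr1 => coer.
have B_adj x y : ip x (B y) = ip (B x) y.
  by rewrite ipDr ipDl -A_adj (adjoint_sym A_adj) addrC.
(* [A] and its adjoint contribute 1/2 each. *)
have B_le x : nm (B x) <= nm x.
  have := nm_adjoint_le A_adj _ A_le x; rewrite invr_ge0 => /(_ (ler0n _ _)).
  by have := nmD (A x) (Astar x); have := A_le x; rewrite /B; lra.
have PfE : ipeq (P f) f := proj_id W_lincomb P_in ip_P Wf.
have LPf : ipeq (L (P f)) (L f) := L_ipeq (W_dom (P_in f)) PfE.
have PLPf := proj_ipeq W_lincomb P_in ip_P LPf.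
have LME : ipeq (LM f) (P0 (L f)) := proj_ipeq W0_lincomb P0_in ip_P0 (L_P0 W0f).
pose q := L (P f) - P (L (P f)).
(* Tested weakly, [L f] splits into its part in [W0], the part [q] orthogonal to [W], and the part
   along [u]. *)
have LfE h : ip (L f) h = ip (LM f) h + ip q h + ip (L f) u * ip u h.
  by rewrite ipBl LPf PLPf proj_split LME ipDl ipZl; ring.
have cross : ip (A (L f)) f + ip (A f) (L f) =
    ip (LM f) (B f) + ip (B q) f + ip (L f) u * ip u (B f).
  by rewrite -B_adj -LfE ipDr -(A_adj (L f)) (ipC (A f)) addrC.
have LMf : ip (- L f) f <= nm (LM f).
  rewrite ipNl -ip_LM// -ipNl; apply: le_trans (ip_le _ _) _.
  by rewrite nmN f1 mulr1.
have LMB : ip (LM f) (B f) <= nm (LM f).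
  apply: le_trans (ip_le _ _) _; rewrite -[leRHS]mulr1.
  by rewrite ler_wpM2l// -f1.
have Bq : ip (B q) f <= delta.
  by apply: le_trans (ip_le _ _) _; rewrite f1 mulr1 delta_le ?f1.
(* Both [f] and [u] lie in [W], so [L] moves onto [u]; the other factor is at most 1. *)
have uB : ip (L f) u * ip u (B f) <= nm (Lstar u).
  apply: le_trans (ler_norm _) _; rewrite normrM -[leRHS]mulr1.
  apply: ler_pM => //.
    by rewrite L_adj//; apply: le_trans (ip_abs_le _ _) _; rewrite f1 mul1r.
  by apply: le_trans (ip_abs_le _ _) _; rewrite nm_u mul1r -f1.
rewrite /lamhat ler_pdivrMr; last by rewrite ltr_pwDl.
have : eps * (ip (A (L f)) f + ip (A f) (L f)) <=
    eps * (nm (LM f) + delta + nm (Lstar u)).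
  by rewrite cross ler_wpM2l//; lra.
by move: coer; rewrite !mulrDr mulr1; lra.
Qed.

Lemma LM_coercive f : W0 f -> lamhat * nm f <= nm (LM f).
Proof.
move=> Wf; have [->|n0] := eqVneq (nm f) 0; first by rewrite mulr0.
have n_gt0 : 0 < nm f by rewrite lt_neqAle eq_sym n0 nm_ge0.
have W00 : W0 0 by split=> //=; rewrite -(scale0r 0) ipZl mul0r.
have Wf1 := W0_lincomb (nm f)^-1 Wf W00.
have := LM_coercive_unit Wf1.
rewrite addr0 nmZ ger0_norm ?invr_ge0// mulVf// => /(_ erefl).
(* Linearity at [a = -1] and [f = g = 0] gives [LM 0 = - LM 0 + LM 0]. *)
have LM0 : ipeq (LM 0) 0.
  move=> h; have := LM_lincomb (-1) W00 W00 h.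
  by rewrite scaler0 addr0 ipDl ipZl mulN1r addNr -(scale0r (0 : H)) ipZl mul0r.
have /ipeq_nm -> : ipeq (LM ((nm f)^-1 *: f)) ((nm f)^-1 *: LM f).
  move=> h; have := LM_lincomb (nm f)^-1 Wf W00 h.
  by rewrite addr0 ipDl LM0 -(scale0r (0 : H)) (ipZl 0) mul0r addr0.
by rewrite nmZ ger0_norm ?invr_ge0// ler_pdivlMl// mulrC.
Qed.

(** Coercivity applied to the discrete error reduces the claim to bounding the residual
    [LM (PhiM - P0 Phi)], which the two equations express through [Phi - P Phi] and [u]. *)
Lemma galerkin_error (Phi r PhiM : H) : 0 < lamhat -> domL Phi ->
  ipeq (- L Phi) (r - ip r one *: one) -> W0 PhiM -> ipeq (- LM PhiM) (P0 r) ->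
  nm (PhiM - P0 Phi) <=
    lamhat^-1 * (nm (P (L (Phi - P Phi))) + nm (L u) * nm Phi).
Proof.
move=> lam0 dPhi PhiE WM PhiME.
have opp x y : x - y = -1 *: y + x by rewrite scaleN1r addrC.
have WD : W0 (PhiM - P0 Phi) by rewrite opp; exact: W0_lincomb.
rewrite mulrC ler_pdivlMr// mulrC; apply: le_trans (LM_coercive WD) _.
have dP : domL (P Phi) by exact: W_dom.
have P0E : ipeq (- ip Phi u *: u + P Phi) (P0 Phi).
  by move=> k; rewrite ipDl ipZl proj_split ipDl ipZl; ring.
have LP0E h : ip (L (P0 Phi)) h = ip (L (P Phi)) h - ip Phi u * ip (L u) h.
  rewrite -(L_ipeq _ P0E); last exact/W_dom/W_lincomb.
  by rewrite L_lincomb ?ipDl ?ipZl; [ring|exact: W_dom|].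
have residual : ipeq (LM (PhiM - P0 Phi))
    (ip Phi u *: P0 (L u) + P0 (L (Phi - P Phi))).
  move=> h; rewrite -(proj_lincomb W0_lincomb P0_in ip_P0); move: h.
  have sym x y : ipeq x y -> ipeq y x by move=> xy h.
  apply: sym; apply: proj_unique W0_lincomb P0_in ip_P0 _ _ _ _.
    exact: P0_in.
  move=> h Wh; rewrite ipDl ipZl [in RHS]opp L_lincomb// opp LM_lincomb//.
  rewrite !ipDl !ipZl (ip_LM (P0_in _) Wh) LP0E.
  have := PhiME h; rewrite ip_P0//.
  (* The test vector is orthogonal to [one], so the mean of [r] drops out and both equations have
     the same right-hand side. *)
  have := PhiE h; rewrite ipBl !ipZl !ipNl (ipC one) Wh.2.
  by lra.
rewrite (ipeq_nm residual); apply: le_trans (nmD _ _) _.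
rewrite addrC; apply: lerD.
  (* Tested against itself, a vector [P0 y] satisfies [|P0 y|^2 = ip (P y) (P0 y)] because [P0 y]
     lies in [W]; hence [|P0 y| <= |P y|]. *)
  apply: nm_le => //; rewrite ip_P0//.
  by rewrite -ip_P ?ip_le//; case: (P0_in (L (Phi - P Phi))).
rewrite nmZ mulrC; apply: ler_pM => //.
  exact: nm_proj_le P0_in ip_P0 _.
by apply: le_trans (ip_abs_le _ _) _; rewrite nm_u mulr1.
Qed.

End galerkin.

(** * The Galerkin estimate in L^2(mu) *)

Section L2_galerkin.
Local Set Implicit Arguments.
Local Unset Strict Implicit.
Context (d : measure_display) (T : measurableType d) (R : realType).
Context (mu : probability T R).
Implicit Types (f g h : L2 mu) (a : R) (W : set (L2 mu)).

(** Removing the [u] component from each generator of [W] gives generators of the orthogonal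
    complement of [u] in [W]. *)
Lemma finite_dim_orth W u : finite_dim_subspace W -> W u -> dot u u = 1 ->
  finite_dim_subspace (W `&` [set f | dot f u = 0]).
Proof.
move=> fW Wu uu; have [n [b WE]] := fW.
pose b' i := b i - dot (b i) u *: u.
have spanE (c : 'I_n -> R) h : dot (\sum_i c i *: b' i) h =
    dot (\sum_i c i *: b i) h - dot (\sum_i c i *: b i) u * dot u h.
  rewrite !dot_suml mulr_suml -sumrB; apply: eq_bigr => i _.
  by rewrite /b' !(dotBl, dotZl); ring.
exists n, b'; apply/seteqP; split=> [f [Wf fu]|f [c fc]].
  move: Wf; rewrite WE => -[c fc]; exists c; apply/aeqP => h.
  by rewrite spanE -!(aeq_dotl _ fc) fu mul0r subr0.
have Wb : W (\sum_i c i *: b i) by rewrite WE; exists c; exact: aeqxx.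
split; last by rewrite /= (aeq_dotl _ fc) spanE uu mulr1 subrr.
apply: (@finite_dim_aeq _ _ _ _ _
  (\sum_i c i *: b i - dot (\sum_i c i *: b i) u *: u)) => //.
  by apply/aeqP => h; rewrite (aeq_dotl _ fc) spanE dotBl dotZl.
by apply: finite_dimB => //; exact: finite_dimZ.
Qed.

Lemma L20E : L20 = [set f : L2 mu | dot f (L2cst 1) = 0].
Proof. by apply/seteqP; split=> f; rewrite /L20 /= meanE. Qed.

(** The function 1 need not lie in [W], but on [W] the mean is the pairing with its projection [p];
    the case of a unit vector of [W] then applies to [p / |p|]. *)
Lemma finite_dim_L20 W : finite_dim_subspace W ->
  nrm (orth_proj W (L2cst 1)) != 0 -> finite_dim_subspace (W `&` L20).
Proof.
move=> fW p0; have := orth_proj_in fW (L2cst 1); have := dot_orth_proj fW (L2cst 1).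
move: p0; move: (orth_proj W (L2cst 1)) => p p0 pE Wp.
pose u := (nrm p)^-1 *: p.
have -> : W `&` L20 = W `&` [set f | dot f u = 0].
  have oneE f : W f -> dot f (L2cst 1) = dot f p.
    by move=> Wf; rewrite dotC -pE// dotC.
  apply/seteqP; rewrite L20E; split=> f [Wf] /= H.
    by split=> //=; rewrite /u dotZr -oneE// H mulr0.
  split=> //=; rewrite oneE//; move/eqP: H.
  by rewrite /u dotZr mulf_eq0 invr_eq0 (negPf p0) => /eqP.
apply: finite_dim_orth => //; first exact: finite_dimZ.
by rewrite dotZl dotZr -sqr_nrm expr2 mulKf// mulVf.
Qed.

Lemma L2_galerkin (L Lstar : operator mu) (S : set (L2 mu * L2 mu))
    (A Astar : L2 mu -> L2 mu) (lamt eps delta : R) W :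
  let P := orth_proj W in
  let W0 := W `&` L20 in
  let P0 := orth_proj W0 in
  let u := (nrm (P (L2cst 1)))^-1 *: P (L2cst 1) in
  let LM f := P0 (L (P0 f)) in
  let lamhat := (lamt - eps * (delta + nrm (Lstar u))) / (1 + eps) in
  rel_linear S -> graph L = rel_closure S -> graph Lstar = rel_adjoint (graph L) ->
  (forall f g, dot (A f) g = dot f (Astar g)) ->
  (forall f, nrm (A f) <= 2^-1 * nrm f) ->
  0 <= eps -> hypocoercive A lamt eps (graph L) ->
  finite_dim_subspace W -> W `<=` dom L `&` dom Lstar ->
  nrm (P (L2cst 1)) != 0 ->
  (forall f, nrm f <= 1 ->
    let h := L (P f) - P (L (P f)) in nrm (A h + Astar h) <= delta) ->
  0 < lamhat ->
  [/\ invertible_on W0 LM,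
      (opnorm_on W0 (inverse_on W0 LM) <= (lamhat^-1)%:E)%E &
      forall Rhs Phi PhiM : L2 mu,
        dom L Phi -> aeq (- L Phi) (Pi0 Rhs) -> W0 PhiM ->
        aeq (- LM PhiM) (P0 Rhs) ->
        nrm (PhiM - P0 Phi) <=
          lamhat^-1 * (nrm (P (L (Phi - P Phi))) + nrm (L u) * nrm Phi)].
Proof.
move=> P W0 P0 u LM lamhat linS LS LsE A_adj A_le eps0 coer fW W_dom p0 dlt lam0.
have fW0 : finite_dim_subspace W0 := finite_dim_L20 fW p0.
have W0E : W0 = W `&` [set f | dot f (L2cst 1) = 0] by rewrite /W0 L20E.
have P_in f : W (P f) := orth_proj_in fW f.
have P_dot f h : W h -> dot (P f) h = dot f h := fun Wh => dot_orth_proj fW f Wh.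
have P0_in f : W0 (P0 f) := orth_proj_in fW0 f.
have P0_dot f h : W0 h -> dot (P0 f) h = dot f h.
  exact: dot_orth_proj fW0 f h.
have domW : W `<=` dom L by move=> f /W_dom[].
have L_ipeq f g : dom L f -> ipeq dot f g -> ipeq dot (L f) (L g).
  by move=> df /aeqP fg; apply/aeqP; exact: op_aeq LS _ _ df fg.
have L_lin a f g : dom L f -> dom L g ->
    ipeq dot (L (a *: f + g)) (a *: L f + L g).
  by move=> df dg; apply/aeqP; exact: op_lincomb linS LS a _ _ df dg.
have L_adj f g : W f -> W g -> dot (L f) g = dot f (Lstar g).
  move=> /domW df /W_dom[_ dg].
  have : rel_adjoint (graph L) (g, Lstar g) by rewrite -LsE; split=> //; exact: aeqxx.
  by move=> /(_ (f, L f)); apply; split=> //; exact: aeqxx.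
have W0_coer f : W0 f -> lamt * nrm f ^+ 2 <=
    dot (- L f) f + eps * dot (A (L f)) f + eps * dot (A f) (L f).
  move=> [Wf f0]; have gLf : graph L (f, L f).
    by split; [exact: domW|exact: aeqxx].
  (* On mean-zero [f] the inequality on the graph becomes the coercivity assumed in the abstract
     estimate. *)
  have Pf : Pi0 f = f by rewrite /Pi0 f0 scale0r subr0.
  by have := coer _ _ gLf; rewrite Pf.
have Wlin a f g : W f -> W g -> W (a *: f + g) by exact: finite_dim_lincomb.
have W_0 : W 0 := finite_dim0 fW.
have LM_co f : W0 f -> lamhat * nrm f <= nrm (LM f).
  rewrite W0E in P0_in P0_dot W0_coer *.
  by apply: (LM_coercive (@dotC _ _ _ mu) (@dotDl _ _ _ mu) (@dotZl _ _ _ mu)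
    (@nrm_ge0 _ _ _ mu) (@sqr_nrm _ _ _ mu) (@cauchy_schwarz _ _ _ mu)
    L_ipeq L_lin domW W_0 Wlin L_adj A_adj A_le eps0 W0_coer P_in P_dot
    P0_in P0_dot p0 (erefl u) dlt).
have inv : invertible_on W0 LM.
  apply: (injective_invertible_on fW0).
  - by move=> f _; exact: P0_in.
  - move=> f g Wf /aeqP fg; apply/aeqP; rewrite W0E in P0_in P0_dot *.
    exact: (LM_ipeq (@dotDl _ _ _ mu) (@dotZl _ _ _ mu)
      (@sqr_nrm _ _ _ mu) (@cauchy_schwarz _ _ _ mu) L_ipeq domW Wlin P0_in P0_dot fg).
  - move=> a f g Wf Wg; apply/aeqP; rewrite W0E in Wf Wg P0_in P0_dot *.
    exact: (LM_lincomb (@dotDl _ _ _ mu) (@dotZl _ _ _ mu)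
      (@sqr_nrm _ _ _ mu) (@cauchy_schwarz _ _ _ mu) L_ipeq L_lin domW Wlin
      P0_in P0_dot a Wf Wg).
  move=> f Wf /aeq_nrm; rewrite nrm0 => LM0.
  apply: nrm0_aeq; apply/eqP; rewrite eq_le nrm_ge0 andbT.
  by rewrite -(pmulr_rle0 _ lam0) -LM0 LM_co.
split=> //.
  apply: ge_ereal_sup => _ [g [Wg g1] <-]; rewrite lee_fin.
  (* A preimage exists, so [inverse_on] does not return its default 0; coercivity then bounds the
     norm of its value by [lamhat^-1 |g|]. *)
  have [_ /(_ g Wg)[f [Wf LMf] _]] := inv.
  have [Wi LMi] : [set f | W0 f /\ aeq (LM f) g] (inverse_on W0 LM g).
    by rewrite /inverse_on; case: xgetP => [y -> //|/(_ f)]; case.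
  have := LM_co _ Wi; rewrite (aeq_nrm LMi) => H.
  by rewrite -(ler_pM2l lam0) divff ?gt_eqF// (le_trans H).
move=> Rhs Phi PhiM dPhi /aeqP PhiE WM /aeqP PhiME; rewrite Pi0E in PhiE.
rewrite W0E in P0_in P0_dot W0_coer WM.
by apply: (galerkin_error (@dotC _ _ _ mu) (@dotDl _ _ _ mu) (@dotZl _ _ _ mu)
    (@nrm_ge0 _ _ _ mu) (@sqr_nrm _ _ _ mu) (@cauchy_schwarz _ _ _ mu)
    L_ipeq L_lin domW W_0 Wlin L_adj A_adj A_le eps0 W0_coer P_in P_dot
    P0_in P0_dot p0 (erefl u) dlt lam0 dPhi PhiE WM PhiME).
Qed.

End L2_galerkin.

(** * Application to the Langevin generator and passage to large [M] *)

Theorem theorem3 (R : realType) (D : nat) (hD : (1 <= D)%N)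
  (X : position_space R) (beta m : R) (hbeta : 0 < beta) (hm : 0 < m)
  (V : 'rV[R]_D -> R) (hV : smooth_position X V)
  (hZ : (lebesgue_rV R D).-integrable (cell X)
          (fun q => (expR (- beta * V q))%:E))
  (mu : probability ('rV[R]_D * 'rV[R]_D)%type R)
  (nu kappa : probability 'rV[R]_D R)
  (hmu : is_mu X V beta m mu) (hnu : is_nu X V beta nu)
  (hkappa : is_kappa beta m kappa)
  (Cnu : R) (hCnu : 0 < Cnu) (hpoincare : poincare X nu Cnu)
  (c1 c2 c3 : R) (hc1 : 0 < c1) (hc2 : 0 <= c2 < 1) (hc3 : 0 < c3)
  (hlaplacian : forall q,
    laplacian V q <= c1 + c2 / 2 * sqnorm (grad V q))
  (hhessian : forall q,
    hessian_norm V q <= c3 * (1 + Num.sqrt (sqnorm (grad V q))))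
  (A Astar : L2 mu -> L2 mu) (hA : is_A X V m kappa A)
  (hAstar : forall f g, dot (A f) g = dot f (Astar g))
  (epsbar lambar : R) (lamt : R -> R)
  (hepsbar : 0 < epsbar < 1) (hlambar : 0 < lambar)
  (hlamt : forall gamma, 0 < gamma -> 0 < lamt gamma) :
  let eps gamma := epsbar * Num.min gamma gamma^-1 in
  let lam gamma := lamt gamma / (1 + eps gamma) in
  (* hypocoercivity on Pi_0 C_c^oo: here phi = Pi0 f and g = L phi *)
  (forall gamma, 0 < gamma -> forall f g : L2 mu,
    test_phase X f ->
    (forall x, g x = langevin V beta m gamma (Pi0 f) x) ->
    lamt gamma * nrm (Pi0 f) ^+ 2 <=
      dot (- g) (Pi0 f) + eps gamma * dot (A g) (Pi0 f)
      + eps gamma * dot (A (Pi0 f)) g) ->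
  (forall gamma, 0 < gamma ->
    lambar * Num.min gamma gamma^-1 <= lam gamma) ->
  exists C : R, 1 <= C /\
  forall gamma : R, 0 < gamma ->
  forall L Lstar : operator mu,
    is_generator X V beta m gamma L ->
    graph Lstar = rel_adjoint (graph L) ->
  forall VM : nat -> set (L2 mu),
    (forall M, (1 <= M)%N -> finite_dim_subspace (VM M)) ->
    (forall M, (1 <= M)%N -> VM M `<=` dom L `&` dom Lstar) ->
  let Pi M := orth_proj (VM M) in
  let VM0 M := VM M `&` L20 in
  let Pi_0 M := orth_proj (VM0 M) in
  let one : L2 mu := L2cst 1 in
  let u M := (nrm (Pi M one))^-1 *: Pi M one in
  let LM M f := Pi_0 M (L (Pi_0 M f)) in
    (forall M, (1 <= M)%N -> nrm (Pi M one) != 0) ->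
    (fun M => opnorm_on setT (fun f =>
       let h := L (Pi M f) - Pi M (L (Pi M f)) in A h + Astar h))
      @ \oo --> 0%E ->
    (fun M => nrm (Lstar (u M))) @ \oo --> 0 ->
  exists M0 : nat, (1 <= M0)%N /\
  exists lamhat : nat -> R,
    [/\ forall M, (M0 <= M)%N -> 0 < lamhat M,
        lamhat @ \oo --> lam gamma,
        forall M, (M0 <= M)%N ->
          invertible_on (VM0 M) (LM M) /\
          (opnorm_on (VM0 M) (inverse_on (VM0 M) (LM M))
             <= (C / lamhat M)%:E)%E &
        forall M, (M0 <= M)%N -> forall Rhs Phi PhiM : L2 mu,
          dom L Phi -> L20 Phi -> aeq (- L Phi) (Pi0 Rhs) ->
          VM0 M PhiM -> aeq (- LM M PhiM) (Pi_0 M Rhs) ->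
          nrm (PhiM - Pi_0 M Phi) <=
            C / lamhat M *
            (nrm (Pi M (L (Phi - Pi M Phi))) + nrm (L (u M)) * nrm Phi)].
Proof.
move=> eps lam hypo _; exists 1; split=> // gamma g0 L Lstar LS LsE VM fV V_dom.
move=> Pi VM0 Pi_0 one u LM p0 hdelta hu.
have eps_gt0 : 0 < eps gamma.
  rewrite /eps mulr_gt0//; first by case/andP: hepsbar.
  by rewrite lt_min g0 invr_gt0.
have A_le f : nrm (A f) <= 2^-1 * nrm f.
  (* By [hA] the pair [(f, A f)] belongs to the closure of the resolvent relation. *)
  apply: (rel_closure_nrm_le _ (fun z => @resolvent_nrm_le _ _ _ _ _ z.1 z.2)).
    by rewrite invr_ge0.
  by apply/hA; exact: aeqxx.
have coer : hypocoercive A (lamt gamma) (eps gamma) (graph L).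
  rewrite LS; apply: hypocoercive_closure A_le _; first exact: adjoint_linear hAstar.
  move=> f g [/= tf fg]; apply: (hypo gamma g0 f g tf) => x.
  by rewrite fg langevin_Pi0.
pose on M := opnorm_on setT (fun f =>
  let h := L (Pi M f) - Pi M (L (Pi M f)) in A h + Astar h).
(* The operator norms are extended reals. Converging to 0, they are eventually finite, and only then
   does [fine] return the true norm. *)
have /fine_cvgP[on_fin on_cvg] : on @ \oo --> 0%:E by [].
pose lamhat M := (lamt gamma - eps gamma * (fine (on M) + nrm (Lstar (u M))))
  / (1 + eps gamma).
have lamhat_cvg : lamhat @ \oo --> lam gamma.
  have -> : lam gamma = (lamt gamma - eps gamma * (0 + 0)) / (1 + eps gamma).
    by rewrite addr0 mulr0 subr0.
  apply: cvgM; last exact: cvg_cst.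
  apply: cvgB; first exact: cvg_cst.
  apply: cvgM; first exact: cvg_cst.
  exact: cvgD on_cvg hu.
have lam_gt0 : 0 < lam gamma by rewrite divr_gt0 ?hlamt// ltr_pwDl// ltW.
have : \forall M \near \oo, 0 < lamhat M /\ on M \is a fin_num.
  near=> M; split; last by near: M.
  by near: M; exact: (cvgr_gt (lam gamma)) lamhat_cvg _ lam_gt0.
(* Beyond [N] the rate is positive and the norm finite; the maximum with 1 is taken because the
   assumptions on [VM] start at index 1. *)
move=> [N _ HN]; exists (maxn N 1); split; first by rewrite leq_maxr.
have galerkin M : (maxn N 1 <= M)%N -> 0 < lamhat M /\
    [/\ invertible_on (VM0 M) (LM M),
      (opnorm_on (VM0 M) (inverse_on (VM0 M) (LM M)) <= ((lamhat M)^-1)%:E)%E &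
      forall Rhs Phi PhiM : L2 mu,
        dom L Phi -> aeq (- L Phi) (Pi0 Rhs) -> VM0 M PhiM ->
        aeq (- LM M PhiM) (Pi_0 M Rhs) ->
        nrm (PhiM - Pi_0 M Phi) <= (lamhat M)^-1 *
          (nrm (Pi M (L (Phi - Pi M Phi))) + nrm (L (u M)) * nrm Phi)].
  rewrite geq_max => /andP[NM M1]; have [lam0 fin_on] := HN M NM; split=> //.
  have delta_le f : nrm f <= 1 ->
      let h := L (Pi M f) - Pi M (L (Pi M f)) in nrm (A h + Astar h) <= fine (on M).
    by move=> f1; rewrite /= -lee_fin fineK//; apply: ereal_sup_ubound; exists f.
  have linS := @langevin_core_linear _ _ X V beta m gamma mu.
  exact: (L2_galerkin linS LS LsE hAstar A_le (ltW eps_gt0) coer (fV M M1)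
    (V_dom M M1) (p0 M M1) delta_le lam0).
exists lamhat; split=> //.
- by move=> M /galerkin[].
- by move=> M /galerkin[_ []]; rewrite div1r.
move=> M /galerkin[_ [_ _ err]] Rhs Phi PhiM dPhi _.
by rewrite div1r; exact: err.
Unshelve. all: by end_near. Qed.
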